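(* Let $I$ be an interval on the real line, let $\psi : I \to \mathbb{R}$ be a continuous function and let $\mathcal{C}>0$ be a parameter such that the following two conditions hold: for all real numbers $\delta_1,\delta_2$ with $\delta_1 \neq 0$, $$|\{(x,y)\in I^2 : x-y=\delta_1,\ \psi(x)-\psi(y)=\delta_2\}| \ll_{\mathcal{C}} 1,$$ and for all real numbers $n_1,n_2$, $$|\{(x,y)\in I^2 : x+y=n_1,\ \psi(x)+\psi(y)=n_2\}| \ll_{\mathcal{C}} 1.$$ Let $A$ be a finite subset of $I$ with $|A| \geq 2$, let $s \geq 5$ be a natural number and let $c = 1/7246$. Then $$E_{s,3}(A) \ll_{\mathcal{C}} |A|^{3s-6+(1/4-c)\cdot 2^{-s+5}} \log|A|.$$
   Context: For $\mathbf{n}=(n_1,n_2)\in\mathbb{R}^2$, $r_s(\mathbf{n})$ is the number of $(x_1,\dots,x_s)\in A^s$ with $\sum_{i=1}^s x_i = n_1$ and $\sum_{i=1}^s \psi(x_i) = n_2$. Then $E_{s,3}(A) = \sum_{\mathbf{n}} r_s(\mathbf{n})^3$, the sum being over the finitely many $\mathbf{n}\in\mathbb{R}^2$ with $r_s(\mathbf{n})>0$. The notation $X \ll_{\mathcal{C}} Y$ means $|X| \leq K|Y|$ for some constant $K>0$ depending only on $\mathcal{C}$ (after renaming the parameter, the two conditions on $I,\psi$ say that the stated cardinalities are at most $\mathcal{C}$). *)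

(* Defs.v *)
From HB Require Import structures.
From mathcomp Require Import all_boot all_order all_algebra finmap.
From mathcomp Require Import all_classical all_reals all_analysis.
Import Order.TTheory GRing.Theory Num.Theory.
Import numFieldNormedType.Exports.

Set Implicit Arguments.
Unset Strict Implicit.
Unset Printing Implicit Defensive.

Local Open Scope classical_set_scope.
Local Open Scope ring_scope.

(* The finiteness conjunct is needed: [fset_set S] is empty by convention when
   [S] is infinite. *)
Definition card_at_most (R : realType) (T : choiceType) (S : set T) (C : R) :
    Prop :=
  finite_set S /\ #|` fset_set S|%:R <= C.

(* [psi] is a function on the whole line, but only its values on [I] matter. *)
Definition few_differences (R : realType) (I : set R) (psi : R -> R) (C : R) :
    Prop :=
  forall d1 d2 : R, d1 != 0 ->
    card_at_most [set xy : R * R | [/\ I xy.1, I xy.2, xy.1 - xy.2 = d1 &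
                                       psi xy.1 - psi xy.2 = d2]] C.

Definition few_sums (R : realType) (I : set R) (psi : R -> R) (C : R) : Prop :=
  forall n1 n2 : R,
    card_at_most [set xy : R * R | [/\ I xy.1, I xy.2, xy.1 + xy.2 = n1 &
                                       psi xy.1 + psi xy.2 = n2]] C.

Definition rep (R : realType) (psi : R -> R) (A : {fset R}) (s : nat)
    (n : R * R) : nat :=
  #|[set x : {ffun 'I_s -> A} | (\sum_(i < s) val (x i) == n.1) &&
                                (\sum_(i < s) psi (val (x i)) == n.2)]%SET|.

(* The finitely supported sum would be 0 if its index set were infinite;
   [finite_rep_support] rules this out. *)
Definition third_energy (R : realType) (psi : R -> R) (A : {fset R})
    (s : nat) : R :=
  \sum_(n \in [set n : R * R | (0 < rep psi A s n)%N])
    ((rep psi A s n)%:R ^+ 3 : R).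

Lemma finite_rep_support (R : realType) (psi : R -> R) (A : {fset R})
    (s : nat) : finite_set [set n : R * R | (0 < rep psi A s n)%N].
Proof.
pose f (x : {ffun 'I_s -> A}) : R * R :=
  (\sum_(i < s) val (x i), \sum_(i < s) psi (val (x i))).
apply: (@sub_finite_set _ _ (f @` setT)); last exact/finite_image/finite_finset.
move=> n /= /card_gt0P[x]; rewrite inE => /andP[/eqP n1 /eqP n2].
by exists x => //; rewrite /f n1 n2 -surjective_pairing.
Qed.

(* Main.v *)
(** Put P = {(a, psi a) : a in A}, N = |A|, let r_s(n) count the representations
    of n as a sum of s points of P, and let E_s be the sum of r_s^2.

    Two translates of the graph of psi meet boundedly often, so the
    Szemeredi-Trotter bound holds for translates of P.  Its weighted form is
    #{n : r_s(n) >= t} << N^(s-1) E_(s-1) t^(-3), whence E_s^2 << N^(2s-1) E_(s-1)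
    and sum_n r_s(n)^3 << N^(s-1) E_(s-1) log N, uniformly in s.  So everything
    follows from a bound for E_4 with exponent below 5 + 1/4.

    For this let f(x) be the number of solutions of x = a + b - c - d in P, so
    that E_4 is the sum of f^2, while F, the sum of f^3, is << N^3 E_3 log N.  If
    E_4 were as large as F permits, the popular differences would be nearly
    closed under addition, and E_6 would be too large.  Quantitatively,
    Cauchy-Schwarz on triangles in P + P weighted by f gives
    E_4^15 << N^24 F^7 E_6, hence E_4^59 << N^309 (log N)^28, and
    309/59 < 5 + 1/4 - 1/7246. *)
Require Import Defs.
From HB Require Import structures.
From mathcomp Require Import all_boot all_order all_algebra finmap.
From mathcomp Require Import all_classical all_reals all_analysis.
From mathcomp Require Import zify ring lra.
Import Order.TTheory GRing.Theory Num.Theory.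
Import numFieldNormedType.Exports.

Set Implicit Arguments.
Unset Strict Implicit.
Unset Printing Implicit Defensive.

(** * A sweep lemma *)

(** The incidence bound comes from sweeping a vertical line. The translates through a point occupy
    consecutive ranks, and two points share few translates, so many rich points force many rank
    changes; but two translates change order only boundedly often. Only the order and the
    intermediate value theorem enter.

    All constants must be independent of [s], and two losses threaten this. Cutting the weights
    dyadically could cost a logarithm at every convolution; instead each level of the weight gets
    its own incidence parameter, and the sum of these parameters telescopes. In the third moment a
    logarithm of the largest value would grow like s log N; only values between sqrt(E/N) and the
    maximum are summed harmonically, and their ratio is O(N).

    Passing from E_s to the square root of N^(2s+1) E_s halves the excess of the exponent over 2s-3;
    this is where the power of 2 in the theorem comes from. Absorbing (log N)^28 into N^(1/2) gives
    309.5/59 = 5 + 1/4 - 1/236, so every saving up to 1/236 is reached. *)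

Lemma sum_nat_interval (n a b : nat) :
  \sum_(o < n) ((a <= o < b) : nat) = minn n b - a.
Proof.
elim: n => [|n IH]; first by rewrite big_ord0; lia.
by rewrite big_ord_recr /= IH; case: (boolP (a <= n < b)); lia.
Qed.

(** Each further set meets the union of the others in at most [c * size s] elements, so at least
    half of its [t] elements are new. *)
Lemma card_bigcup_almost_disjoint (M : finType) (B : nat -> {set M})
    (c t : nat) (s : seq nat) :
  uniq s -> 2 * c * size s <= t ->
  (forall l, l \in s -> t <= #|B l|) ->
  (forall l l', l \in s -> l' \in s -> l != l' -> #|B l :&: B l'| <= c) ->
  size s * t <= 2 * #|\bigcup_(l <- s) B l|.
Proof.
elim: s => [|a s IH] //= /andP[a_s us] ct hB hI.
rewrite big_cons.
have {}IH : size s * t <= 2 * #|\bigcup_(l <- s) B l|.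
  apply: IH => //; first lia.
  - by move=> l ls; apply: hB; rewrite inE ls orbT.
  - by move=> l l' ls ls'; apply: hI; rewrite inE ?ls ?ls' orbT.
have meet : #|B a :&: \bigcup_(l <- s) B l| <= c * size s.
  have : a \notin s by [].
  have : {subset s <= a :: s} by move=> l ls; rewrite inE ls orbT.
  move: {1 3 4 5}s => s'.
  elim: s' => [|b s' IHs] sub; first by rewrite big_nil finset.setI0 cards0.
  rewrite inE negb_or => /andP[ab as'].
  rewrite big_cons finset.setIUr /= mulnS.
  apply: (leq_trans (leq_card_setU _ _)); apply: leq_add.
    by apply: hI => //; [rewrite mem_head | apply: sub; rewrite mem_head].
  by apply: IHs => // l ls; apply: sub; rewrite inE ls orbT.
have := cardsUI (B a) (\bigcup_(l <- s) B l).
have := hB a (mem_head _ _).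
move: ct; rewrite [_.+1 * t]mulSn -mulnA mulnS; lia.
Qed.

Lemma cardsE_sum (T : finType) (A : {set T}) : #|A| = \sum_j (j \in A : nat).
Proof. by rewrite -sum1_card big_mkcond. Qed.

Lemma leq_card_rank_window (M : finType) (f : M -> nat) (o g : nat) :
  injective f -> #|[set j | f j < o <= f j + g]| <= g.
Proof.
move=> f_inj; rewrite cardE -(size_map f).
rewrite -[leqRHS](size_iota (o - g)).
apply: uniq_leq_size; first by rewrite map_inj_uniq // enum_uniq.
by move=> v /mapP[j]; rewrite mem_enum inE mem_iota => ? ->; lia.
Qed.

(* [rk l] is the ranking of the curves of [M] at time [l] and [B l] a set of
   curves through one point, occupying consecutive ranks at that time. *)
Section Sweep.
Variables (M : finType) (q : nat) (rk : nat -> M -> nat) (B : nat -> {set M}).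
Variables (st : nat -> nat) (t c : nat).
Hypothesis rk_inj : forall l, injective (rk l).
Hypothesis rk_lt : forall l j, rk l j < #|M|.
Hypothesis t_gt0 : 0 < t.
Hypothesis leq_card_B : forall l, l < q -> t <= #|B l|.
Hypothesis B_rk : forall l j, l < q -> j \in B l -> st l <= rk l j < st l + t.
Hypothesis card_BI : forall l l', l < q -> l' < q -> l != l' ->
  #|B l :&: B l'| <= c.

Let moves := \sum_(0 <= l < q) \sum_j ((rk l.+1 j - rk l j) + (rk l j - rk l.+1 j)).

(* [w] blocks lying in a window of [g] ranks have a union of size at least
   [w * t / 2 >= 2 * g], so at least [g] elements have entered the window. *)
Section Window.
Variables (g w o : nat).
Hypothesis cw : 2 * c * w <= t.
Hypothesis gw : 4 * g <= w * t.

Let W l := [set j | rk l j < o <= rk l j + g].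
Let inW l : bool := st l + t <= o <= st l + g.
Let ent l := #|W l.+1 :\: W l|.

(** A curve seen in the window between times [l0] and [l1] either was there at [l0] or entered
    later; the set [U] of the proof collects these curves. *)
Lemma bigcup_window (l0 l1 : nat) : l0 <= l1 -> l1 <= q ->
  #|W l1 :|: \bigcup_(l <- [seq l <- index_iota l0 l1 | inW l]) B l| <=
  g + \sum_(l0 <= l < l1) ent l.
Proof.
move=> l01 l1q.
suff [U sub lU] : exists2 U : {set M},
    W l1 :|: \bigcup_(l <- [seq l <- index_iota l0 l1 | inW l]) B l \subset U &
    #|U| <= g + \sum_(l0 <= l < l1) ent l.
  by apply: leq_trans lU; apply: subset_leq_card.
elim: l1 l01 l1q => [|l1 IH] l01 l1q.
  have -> : l0 = 0 by lia.
  exists (W 0); last by rewrite big_geq // addn0 leq_card_rank_window.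
  by rewrite big_nil finset.setU0.
case: (leqP l0 l1) => [l01'|]; last first.
  move=> l10; have -> : l0 = l1.+1 by lia.
  exists (W l1.+1); last by rewrite big_geq // addn0 leq_card_rank_window.
  by rewrite /index_iota subnn /= big_nil finset.setU0.
have [//||U sub lU] := IH; first lia.
exists (U :|: (W l1.+1 :\: W l1)).
  rewrite /index_iota subSn // -(addn1 (l1 - l0)) iotaD filter_cat big_cat /=.
  rewrite subnKC //.
  have WU : W l1 \subset U by apply: fintype.subset_trans sub; exact: finset.subsetUl.
  have BU : \bigcup_(l <- [seq l <- index_iota l0 l1 | inW l]) B l \subset U.
    by apply: fintype.subset_trans sub; exact: finset.subsetUr.
  apply/fintype.subsetP => j; rewrite !inE => /or3P[jW|jB|].
  - case: (boolP (j \in W l1)) => [jW1|]; first by rewrite (fintype.subsetP WU).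
    by rewrite inE => ->; rewrite jW orbT.
  - by rewrite (fintype.subsetP BU).
  case: ifP => [inw|]; last by rewrite big_nil inE.
  rewrite big_seq1 => jB; apply/orP; left; apply: (fintype.subsetP WU).
  by rewrite inE; have := B_rk l1q jB; move: inw; rewrite /inW; lia.
rewrite big_nat_recr //= addnA.
by apply: (leq_trans (leq_card_setU _ _)); rewrite leq_add2r.
Qed.

Lemma entries_chunk (l0 l1 : nat) : l0 <= l1 -> l1 <= q ->
  \sum_(l0 <= l < l1) inW l = w -> g <= \sum_(l0 <= l < l1) ent l.
Proof.
move=> l01 l1q nw.
set s := [seq l <- index_iota l0 l1 | inW l].
have szs : size s = w by rewrite size_filter -sum1_count big_mkcond.
have sq l : l \in s -> l < q by rewrite mem_filter mem_index_iota; lia.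
have := bigcup_window l01 l1q; rewrite -/s.
have : size s * t <= 2 * #|\bigcup_(l <- s) B l|.
  apply: (@card_bigcup_almost_disjoint _ _ c).
  - by rewrite filter_uniq // iota_uniq.
  - by rewrite szs.
  - by move=> l /sq; apply: leq_card_B.
  - by move=> l l' /sq lq /sq lq'; apply: card_BI.
have := subset_leq_card (finset.subsetUr (W l1) (\bigcup_(l <- s) B l)).
rewrite szs; lia.
Qed.

(** Time is cut greedily into chunks with exactly [w] blocks in the window. A full chunk is paid for
    by [g] entries; the unfinished one, starting at [l0], is responsible for the summand [g * w]. *)
Lemma window_count :
  g * \sum_(0 <= l < q) inW l <= w * \sum_(0 <= l < q) ent l + g * w.
Proof.
suff: forall l1, l1 <= q -> exists l0, [/\ l0 <= l1,
    g * \sum_(0 <= l < l0) inW l <= w * \sum_(0 <= l < l0) ent l &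
    \sum_(l0 <= l < l1) inW l <= w].
  move=> /(_ q (leqnn q))[l0 [l0q H H']].
  rewrite (big_cat_nat (leq0n l0) l0q) //= [in X in w * X](big_cat_nat (leq0n l0) l0q) //=.
  nia.
elim=> [|l1 IH] l1q; first by exists 0; split; rewrite ?big_geq ?muln0.
have [l0 [l01 H H']] := IH (ltnW l1q).
have [lt_w|] := leqP (\sum_(l0 <= l < l1.+1) inW l) w.
  by exists l0; split=> //; exact: leqW.
rewrite big_nat_recr //= => gt_w.
have eq_w : \sum_(l0 <= l < l1) inW l = w.
  by move: gt_w H'; case: (inW l1) => /=; lia.
have ent_g := entries_chunk l01 (ltnW l1q) eq_w.
have [w0|w_gt0] := posnP w.
  have g0 : g = 0 by move: gw; rewrite w0; lia.
  by exists l1.+1; split; rewrite // ?g0 ?mul0n // big_geq.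
exists l1; split; first exact: leqnSn; last first.
  by rewrite big_nat1; apply: leq_trans (leq_b1 _) _.
rewrite (big_cat_nat (leq0n l0) l01) //= [in X in w * X](big_cat_nat (leq0n l0) l01) //=.
rewrite eq_w; nia.
Qed.

End Window.

(** [window_count] is summed over all window positions [o]: each block lies in at least [g - t]
    windows, and a curve whose rank changes by d enters at most d of them. *)
Lemma sweep_window (g w : nat) : 2 * c * w <= t -> 4 * g <= w * t ->
  g * (q * (g - t)) <= w * moves + (#|M| + g).+1 * (g * w).
Proof.
move=> cw gw.
pose inW o l : bool := st l + t <= o <= st l + g.
pose ent o l := #|[set j | rk l.+1 j < o <= rk l.+1 j + g] :\:
                  [set j | rk l j < o <= rk l j + g]|.
have st_lt l : l < q -> st l < #|M|.
  move=> lq; have /card_gt0P[j jB] : 0 < #|B l|.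
    by apply: leq_trans (leq_card_B lq).
  by have := B_rk lq jB; have := rk_lt l j; lia.
have count_in : q * (g - t) <= \sum_(o < (#|M| + g).+1) \sum_(0 <= l < q) inW o l.
  rewrite exchange_big /= -[q in q * _]subn0 -sum_nat_const_nat.
  rewrite big_nat [leqRHS]big_nat; apply: leq_sum => l /= lq.
  rewrite (eq_bigr (fun o : 'I__ => (st l + t <= o < (st l + g).+1) : nat)) //.
  have := st_lt l lq; rewrite sum_nat_interval. by move: #|M| => m; clear; lia.
have count_ent : \sum_(o < (#|M| + g).+1) \sum_(0 <= l < q) ent o l <= moves.
  rewrite exchange_big; apply: leq_sum => l _.
  rewrite /ent; under eq_bigr do rewrite cardsE_sum.
  rewrite exchange_big; apply: leq_sum => j _.
  have := sum_nat_interval (#|M| + g).+1 (rk l.+1 j).+1 (rk l j).+1.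
  have := sum_nat_interval (#|M| + g).+1 (rk l j + g).+1 (rk l.+1 j + g).+1.
  set s1 := \sum_(o < _) _ => e1; set s2 := \sum_(o < _) _ => e2.
  apply: (@leq_trans (s2 + s1)); last by rewrite e1 e2; lia.
  rewrite -big_split /=; apply: leq_sum => o _; rewrite !inE; lia.
have : \sum_(o < (#|M| + g).+1) g * \sum_(0 <= l < q) inW o l <=
       \sum_(o < (#|M| + g).+1) (w * (\sum_(0 <= l < q) ent o l) + g * w).
  by apply: leq_sum => o _; apply: window_count.
rewrite big_split /= -!big_distrr /= sum_nat_const card_ord.
move=> /(leq_trans (leq_mul (leqnn g) count_in)) /leq_trans; apply.
by rewrite [g * (_ * w)]mulnCA leq_add2r leq_mul2l count_ent orbT.
Qed.

(** Take [w] and then [g] as large as the window argument permits, about t/(2c) and t^2/(8c). Then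
    [sweep_window] bounds [q] by a multiple of c moves / t^3 + |M| / t. *)
Lemma sweep_bound : 0 < c -> 16 * c <= t ->
  q * t ^ 3 <= 512 * c * moves + 160 * #|M| * t ^ 2.
Proof.
move=> c_gt0 tc.
have [->|q_gt0] := posnP q; first by rewrite mul0n.
pose w := t %/ (2 * c).
have wc : 2 * c * w <= t by rewrite mulnC leq_trunc_div.
have w_large : t <= 4 * c * w.
  by rewrite /w; have := divn_eq t (2 * c); have := ltn_pmod t (_ : 0 < 2 * c); nia.
have union_bound q' : q' <= q -> q' <= w -> q' * t <= 2 * #|M|.
  move=> q'q q'w.
  have := @card_bigcup_almost_disjoint M B c t (iota 0 q') (iota_uniq _ _).
  rewrite size_iota => H; apply: leq_trans (H _ _ _) _ => //.
  - by apply: leq_trans wc; rewrite leq_mul2l q'w orbT.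
  - by move=> l; rewrite mem_iota => lq; apply: leq_card_B; lia.
  - by move=> l l'; rewrite !mem_iota => lq lq' ll'; apply: card_BI => //; lia.
  - by rewrite leq_mul2l max_card orbT.
(* With at most [w] blocks the union bound alone gives q t <= 2 |M|. Otherwise [w] of the blocks
   give w t <= 2 |M|, so the window covers at most half of the ranks. *)
have [q_le_w|w_lt_q] := leqP q w.
  by have := union_bound q (leqnn _) q_le_w; nia.
have wM := union_bound w (ltnW w_lt_q) (leqnn _).
pose g := (w * t) %/ 4.
have gw : 4 * g <= w * t by rewrite mulnC leq_trunc_div.
(* From [16 * c <= t]; it yields g >= 2 t, so that g - t is at least g/2. *)
have w8 : 8 <= w by rewrite /w leq_divRL; lia.
have g_large : w * t < 4 * g.+1 by rewrite [4 * _]mulnC -ltn_divLR.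
have := sweep_window wc gw.
have g2t : 2 * t <= g by nia.
have g8 : w * t <= 8 * g by nia.
have g_le : 2 * g <= #|M| by lia.
have m_gt0 : 0 < #|M| by nia.
move: moves => X Hw.
move: #|M| g_le m_gt0 wM Hw => m g_le m_gt0 wM Hw.
clear - q_gt0 tc c_gt0 wc w_large g2t g8 gw g_le m_gt0 Hw w8.
have H1 : q * g ^ 2 <= 2 * (w * X) + 5 * m * (g * w).
  have : q * g ^ 2 <= 2 * (g * (q * (g - t))).
    have : g <= 2 * (g - t) by lia.
    by move=> H; have := leq_mul (leqnn (g * q)) H; lia.
  have : (m + g).+1 * (g * w) * 2 <= 5 * m * (g * w).
    by rewrite mulnAC leq_mul2r; lia.
  lia.
have H2 : w * (q * w * t ^ 2) <= w * (128 * X + 80 * m * (w * t)).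
  have : (w * t) ^ 2 <= 64 * g ^ 2 by have := leq_mul g8 g8; lia.
  move=> /(leq_mul (leqnn q)).
  have := leq_mul (leqnn (80 * m * w)) gw.
  lia.
rewrite leq_pmul2l in H2; last lia.
have H3 : q * t ^ 3 <= 4 * c * (q * w * t ^ 2).
  by have := leq_mul (leqnn (q * t ^ 2)) w_large; lia.
have H4 : 4 * c * (80 * m * (w * t)) <= 160 * m * t ^ 2.
  by have := leq_mul (leqnn (160 * m * t)) wc; lia.
have := leq_mul (leqnn (4 * c)) H2.
lia.
Qed.
End Sweep.

Local Open Scope classical_set_scope.
Local Open Scope ring_scope.

(** * Incidences with translates of a graph *)

Lemma card_at_most_size (R : realType) (T : choiceType) (S : set T) (c : nat)
    (s : seq T) :
  card_at_most S (c%:R : R) -> uniq s -> (forall x, x \in s -> S x) ->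
  (size s <= c)%N.
Proof.
move=> [fS lS] us sS; rewrite -(ler_nat R); apply: le_trans lS.
rewrite ler_nat; apply: uniq_leq_size => // x /sS Sx.
by rewrite in_fset_set // inE.
Qed.

(** By injectivity no slice of ranks has more elements than its length, so the slices below [a] and
    from [b] on leave at least [b - a] elements. *)
Lemma leq_card_between (T : finType) (J : {set T}) (f : T -> nat) (a b : nat) :
  {in J &, injective f} -> (forall j, j \in J -> (f j < #|J|)%N) ->
  (b <= #|J|)%N -> (b - a <= #|[set j in J | (a <= f j < b)%N]%SET|)%N.
Proof.
move=> f_inj f_lt bJ.
have slice u v : (#|[set j in J | (u <= f j < v)%N]%SET| <= v - u)%N.
  rewrite cardE -(size_map f) -[leqRHS](size_iota u).
  apply: uniq_leq_size.
    rewrite map_inj_in_uniq ?enum_uniq // => i j.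
    by rewrite !mem_enum !inE => /andP[iJ _] /andP[jJ _]; apply: f_inj.
  by move=> w /mapP[j]; rewrite mem_enum inE mem_iota => /andP[_ H] ->; lia.
have : (#|J| <= #|[set j in J | (0 <= f j < a)%N]%SET| +
    #|[set j in J | (a <= f j < b)%N]%SET| +
    #|[set j in J | (b <= f j < #|J|)%N]%SET|)%N.
  apply: (@leq_trans _ _ _ (subset_leq_card _) (leq_trans
    (leq_card_setU _ _) (leq_add (leq_card_setU _ _) (leqnn _)))).
  apply/fintype.subsetP => j jJ; rewrite !inE jJ (f_lt _ jJ) /=; lia.
have := slice 0%N a; have := slice b #|J|; lia.
Qed.

(** * Order changes of two translates along the sweep *)

Section Curves.
Variables (R : realType) (I : set R) (psi : R -> R) (c : nat).
Hypothesis itvI : is_interval I.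
Hypothesis ctsI : {within I, continuous psi}.
Hypothesis diffI : few_differences I psi c%:R.

Definition defined_at (p : R * R) (x : R) : bool := `[< I (x - p.1) >].
Definition height (p : R * R) (x : R) : R := psi (x - p.1) + p.2.

(* Outside its interval of definition a curve is treated as lying at height
   +oo; ties are broken by [tie]. *)
Definition below (tie : bool) (p p' : R * R) (x : R) : bool :=
  if defined_at p x then
    if defined_at p' x then (height p x < height p' x) || (height p x == height p' x) && tie else true
  else ~~ defined_at p' x && tie.

Lemma defined_between (p : R * R) (a b x : R) :
  defined_at p a -> defined_at p b -> a <= x <= b -> defined_at p x.
Proof.
move=> /asboolP Ia /asboolP Ib /andP[ax xb]; apply/asboolP.
by apply: (itvI Ia Ib); rewrite !lerD2r ax xb.
Qed.

Lemma height_within_continuous (p : R * R) (a b : R) :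
  defined_at p a -> defined_at p b -> {within `[a, b], continuous (height p)}.
Proof.
move=> oa ob; apply/subspace_continuousP => x /= xab.
  have I_of y : [set` `[a, b]%R] y -> I (y - p.1).
  by rewrite /= in_itv /= => yab; apply/asboolP; exact: defined_between yab.
apply: cvgD; last exact: cvg_cst.
have psi_cvg := (subspace_continuousP _ _).1 ctsI _ (I_of _ xab).
apply: (cvg_comp (fun y => y - p.1) psi _ psi_cvg).
move=> U IU.
have sub_cvg : y - p.1 @[y --> x] --> x - p.1.
  by apply: cvgB; [exact: cvg_id|exact: cvg_cst].
have near_U := sub_cvg _ IU.
apply: (@filterS _ (nbhs x) _ _ _ _ near_U) => y Iy yab.
by apply: Iy; exact: I_of.
Qed.

(** Three causes are possible: [p] leaves its interval of definition (once, [S1]), [p'] enters its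
    own (once, [S2]), or both are defined at both times ([S3]) and the intermediate value theorem
    yields a common point, of which there are at most [c]. *)
Lemma card_down_switches (p p' : R * R) (tie : bool) (x : nat -> R) (q : nat) :
  p != p' -> {homo x : l l' / (l <= l')%N >-> l <= l'} ->
  (#|[set l : 'I_q | below tie p p' (x l) &&
       ~~ below tie p p' (x l.+1)]%SET| <= c + 2)%N.
Proof.
move=> pp' x_homo.
pose S1 := [set l : 'I_q | defined_at p (x l) && ~~ defined_at p (x l.+1)]%SET.
pose S2 := [set l : 'I_q | ~~ defined_at p' (x l) && defined_at p' (x l.+1)]%SET.
pose S3 := [set l : 'I_q | [&& defined_at p (x l), defined_at p (x l.+1), defined_at p' (x l),
  defined_at p' (x l.+1), below tie p p' (x l) & ~~ below tie p p' (x l.+1)]]%SET.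
have S1_le1 : (#|S1| <= 1)%N.
  apply/card_le1_eqP.
  have wlg (l l' : 'I_q) : l \in S1 -> l' \in S1 -> ~~ (l < l')%N.
    rewrite !inE => /andP[l1 l2] /andP[l'1 _]; apply/negP => ll'.
    by move/negP: l2; apply; apply: defined_between l1 l'1 _; rewrite !x_homo.
  move=> l l' lS l'S; apply: val_inj => /=.
  by have := wlg _ _ lS l'S; have := wlg _ _ l'S lS; lia.
have S2_le1 : (#|S2| <= 1)%N.
  apply/card_le1_eqP.
  have wlg (l l' : 'I_q) : l \in S2 -> l' \in S2 -> ~~ (l < l')%N.
    rewrite !inE => /andP[_ l2] /andP[l'1 l'2]; apply/negP => ll'.
    by move/negP: l'1; apply; apply: defined_between l2 l'2 _; rewrite !x_homo.
  move=> l l' lS l'S; apply: val_inj => /=.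
  by have := wlg _ _ lS l'S; have := wlg _ _ l'S lS; lia.
have S3_le : (#|S3| <= c)%N.
  (* The half-open condition makes the common points of different steps distinct: with [tie] the
     heights differ at the right end of the step, without it at the left end. *)
  pose Z l := [set z : R | [/\ x l <= z <= x l.+1, defined_at p z, defined_at p' z,
    height p z = height p' z & if tie then z < x l.+1 else x l < z]].
  have ZP (l : 'I_q) : l \in S3 -> Z l (xget 0 (Z l)).
    rewrite inE => /and5P[pl pl1 p'l p'l1 /andP[bl nbl]].
    have xl : x l <= x l.+1 by apply: x_homo.
    pose f := (height p - height p' : R -> R).
    have fcts : {within `[x l, x l.+1], continuous f}.
      apply: within_continuousD; first exact: height_within_continuous.
      by move=> z; apply: cvgN; exact: height_within_continuous.
    have fl : if tie then f (x l) <= 0 else f (x l) < 0.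
      move: bl; rewrite /below pl p'l -[f _]/(height p (x l) - height p' (x l)).
      rewrite subr_le0 subr_lt0; case: (tie); rewrite ?andbT ?andbF ?orbF //.
      by move=> /orP[/ltW//|/eqP->].
    have fl1 : if tie then 0 < f (x l.+1) else 0 <= f (x l.+1).
      move: nbl; rewrite /below pl1 p'l1.
      rewrite -[f _]/(height p (x l.+1) - height p' (x l.+1)).
      rewrite subr_ge0 subr_gt0 negb_or -leNgt => /andP[le ne].
      move: ne; case: (tie); rewrite ?andbT // => ne.
      by rewrite lt_neqAle le eq_sym ne.
    have [|z zab fz] := @IVT _ f _ _ 0 xl fcts.
      have fl0 : f (x l) <= 0 by move: fl; case: (tie) => // /ltW.
      have fl10 : 0 <= f (x l.+1) by move: fl1; case: (tie) => // /ltW.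
      by rewrite ge_min le_max fl0 fl10 orbT.
    apply: (@xgetPex _ 0 (Z l)); exists z => /=.
    move: zab; rewrite in_itv /= => zab.
    split=> //; [exact: defined_between zab|exact: defined_between zab| |].
      by apply/eqP; rewrite -subr_eq0; apply/eqP.
    case/andP: zab => z1 z2; case: (tie) fl fl1 => fl fl1.
      rewrite lt_neqAle z2 andbT; apply/eqP => ez.
      by move: fl1; rewrite -ez fz ltxx.
    rewrite lt_neqAle z1 andbT; apply/eqP => ez.
    by move: fl; rewrite ez fz ltxx.
  pose s := [seq (xget 0 (Z l) - p.1, xget 0 (Z l) - p'.1) | l : 'I_q in S3].
  have Z_mono (l l' : 'I_q) : l \in S3 -> l' \in S3 -> (l < l')%N ->
      xget 0 (Z l) < xget 0 (Z l').
    move=> /ZP[/andP[_ z1] _ _ _ z2] /ZP[/andP[z1' _] _ _ _ z2'] ll'.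
    have : x l.+1 <= x l' by apply: x_homo.
    move: z2 z2'; case: (tie) => z2 z2' xx.
      by apply: lt_le_trans z2 (le_trans xx z1').
    by apply: le_lt_trans (le_trans z1 xx) z2'.
  have [->|[l0 l0S]] := set_0Vmem S3; first by rewrite cards0.
  (* With equal first coordinates the curves are vertical translates of each other, and a common
     point would force [p = p']. *)
  have p1 : p'.1 - p.1 != 0.
    apply/negP => /eqP e; move/eqP: pp'; apply.
    have e1 : p.1 = p'.1 by apply/eqP; rewrite eq_sym -subr_eq0 e.
    have [_ _ _ h _] := ZP _ l0S; move: h; rewrite /height e1 => /addrI e2.
    by rewrite (surjective_pairing p) (surjective_pairing p') e1 e2.
  have <- : size s = #|S3| by rewrite size_map -cardE.
  apply: (card_at_most_size (diffI (p'.2 - p.2) p1)).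
    rewrite map_inj_in_uniq ?enum_uniq // => l l'.
    rewrite !mem_enum => lS l'S [/addIr e _].
    apply: val_inj => /=; case: (ltngtP l l') => // ll'.
      by have := Z_mono _ _ lS l'S ll'; rewrite e ltxx.
    by have := Z_mono _ _ l'S lS ll'; rewrite e ltxx.
  move=> v /mapP[l]; rewrite mem_enum => /ZP[_ /asboolP o1 /asboolP o2 h _] -> /=.
  split=> //; first by ring.
  by move: h; rewrite /height => h; lra.
have : (#|S1 :|: S2 :|: S3| <= 1 + 1 + c)%N.
  apply: leq_trans (leq_card_setU _ _) (leq_add _ S3_le).
  exact: leq_trans (leq_card_setU _ _) (leq_add S1_le1 S2_le1).
rewrite addnC; apply: leq_trans; apply: subset_leq_card.
apply/fintype.subsetP => l; rewrite !inE => /andP[bl nbl].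
rewrite bl nbl /= andbT; move: bl nbl; rewrite /below.
by case: (defined_at p (x l)); case: (defined_at p (x l.+1)); case: (defined_at p' (x l));
  case: (defined_at p' (x l.+1)); case: (tie).
Qed.

Definition incident m (p : 'I_m -> R * R) (n : R * R) : {set 'I_m} :=
  [set j | defined_at (p j) n.1 && (height (p j) n.1 == n.2)]%SET.

(** * From order changes to the incidence bound *)

Section Incidences.
Variables (m : nat) (p : 'I_m -> R * R).
Hypothesis p_inj : injective p.

(** Breaking ties by the index makes this a strict total order, so that counting predecessors gives
    an injective ranking at every time. *)
Let bl (x : R) (i j : 'I_m) := below (i < j)%N (p i) (p j) x.

Let bl_irr x i : bl x i i = false.
Proof. by rewrite /bl /below ltxx ltnn !andbF orbF; case: (defined_at _ _). Qed.

Let bl_trans x : transitive (bl x).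
Proof.
move=> j i k; rewrite /bl /below.
case: (defined_at (p i) x); case: (defined_at (p j) x); case: (defined_at (p k) x) => //=; last lia.
case: (ltgtP (height (p i) x) (height (p j) x)) => //= ij.
  case: (ltgtP (height (p j) x) (height (p k) x)) => //= jk.
    by rewrite (lt_trans ij jk).
  by rewrite -jk ij.
rewrite ij; case: (ltgtP (height (p j) x) (height (p k) x)) => //= _; lia.
Qed.

Let bl_total x i j : i != j -> ~~ bl x i j = bl x j i.
Proof.
move=> ij; have {}ij : ~~ (i < j)%N = (j < i)%N.
  by move: ij; rewrite -val_eqE /=; lia.
rewrite /bl /below; case: (defined_at (p i) x); case: (defined_at (p j) x) => //=.
by case: (ltgtP (height (p i) x) (height (p j) x)).
Qed.

Let rk (x : R) (j : 'I_m) := #|[set i | bl x i j]%SET|.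

Let rk_mono x (S : {set 'I_m}) i j : i \in S -> bl x i j ->
  (#|[set k in S | bl x k i]%SET| < #|[set k in S | bl x k j]%SET|)%N.
Proof.
move=> iS ij; apply: proper_card; apply/properP; split.
  apply/fintype.subsetP => k; rewrite !inE => /andP[-> ki].
  exact: bl_trans ki ij.
by exists i; rewrite inE ?iS ?ij ?bl_irr.
Qed.

Let rk_inj_in x (S : {set 'I_m}) :
  {in S &, injective (fun j => #|[set k in S | bl x k j]%SET|)}.
Proof.
move=> i j iS jS /eqP; apply: contraTeq => ij.
case: (boolP (bl x i j)) => [ij'|]; first by rewrite neq_ltn rk_mono.
by rewrite bl_total // => ji; rewrite neq_ltn (rk_mono jS ji) orbT.
Qed.

Let rk_inj x : injective (rk x).
Proof.
move=> i j; rewrite /rk.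
have E k : [set i | bl x i k]%SET = [set i in [set: 'I_m]%SET | bl x i k]%SET.
  by apply/setP => h; rewrite !inE.
by rewrite !E; apply: rk_inj_in; rewrite inE.
Qed.

Let rk_lt x j : (rk x j < #|'I_m|)%N.
Proof.
rewrite -cardsT; apply: proper_card; rewrite properT.
by apply/eqP => /setP/(_ j); rewrite !inE bl_irr.
Qed.

(** A rank changes only through pairs that change order, and an upward change of (j, i) is a
    downward change of (i, j), so [card_down_switches] controls both. *)
Lemma moves_bound (x : nat -> R) (q : nat) :
  {homo x : l l' / (l <= l')%N >-> l <= l'} ->
  (\sum_(0 <= l < q) \sum_j ((rk (x l.+1) j - rk (x l) j) +
     (rk (x l) j - rk (x l.+1) j)) <= 2 * (c + 2) * m ^ 2)%N.
Proof.
move=> x_homo.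
pose sw l i j := (bl (x l) i j && ~~ bl (x l.+1) i j : nat).
have sub_sum (a b : 'I_m -> bool) : (\sum_i a i - \sum_i b i <=
    \sum_i (a i && ~~ b i : nat))%N.
  rewrite leq_subLR -big_split; apply: leq_sum => i _ /=.
  by case: (a i); case: (b i).
have step l j : (rk (x l.+1) j - rk (x l) j + (rk (x l) j - rk (x l.+1) j) <=
    \sum_i (sw l j i + sw l i j))%N.
  rewrite big_split /= /rk !cardsE_sum.
  under [in X in (X - _ + _)%N]eq_bigr do rewrite inE.
  under [in X in (_ - X + _)%N]eq_bigr do rewrite inE.
  under [in X in (_ + (X - _))%N]eq_bigr do rewrite inE.
  under [in X in (_ + (_ - X))%N]eq_bigr do rewrite inE.
  apply: leq_add; apply: (leq_trans (sub_sum _ _)); apply: leq_sum => i _ //.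
  rewrite /sw; have [->|ij] := eqVneq i j; first by rewrite !bl_irr.
  by rewrite -[bl _ i j]bl_total 1?eq_sym // -[bl (x l) i j]bl_total 1?eq_sym // negbK andbC.
apply: (@leq_trans (\sum_(0 <= l < q) \sum_j \sum_i (sw l j i + sw l i j))%N).
  by apply: leq_sum => l _; apply: leq_sum => j _; exact: step.
have pair i j : (\sum_(0 <= l < q) sw l i j <= c + 2)%N.
  have [->|ij] := eqVneq i j.
    by rewrite big1 // => l _; rewrite /sw bl_irr.
  have := @card_down_switches (p i) (p j) (i < j)%N x q _ x_homo.
  rewrite (inj_eq p_inj) => /(_ ij); rewrite cardsE_sum big_mkord.
  by apply: leq_trans; apply: leq_sum => l _; rewrite inE.
rewrite exchange_big /=; under eq_bigr do rewrite exchange_big /=.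
apply: (@leq_trans (\sum_(j < m) \sum_(i < m) ((c + 2) + (c + 2)))%N).
  apply: leq_sum => j _; apply: leq_sum => i _.
  by rewrite big_split; apply: leq_add; exact: pair.
rewrite !sum_nat_const !card_ord; lia.
Qed.

(** The difference condition read dually: a curve through both points gives two points of the graph
    of [psi] with difference [n - n'], and it is determined by them. *)
Lemma card_incI n n' : n != n' -> (#|incident p n :&: incident p n'| <= c)%N.
Proof.
move=> nn'; have [->|[j0 j0S]] := set_0Vmem (incident p n :&: incident p n').
  by rewrite cards0.
have incP n0 j : j \in incident p n0 ->
    [/\ I (n0.1 - (p j).1) & psi (n0.1 - (p j).1) = n0.2 - (p j).2].
  rewrite inE => /andP[/asboolP o /eqP <-]; split=> //.
  by rewrite /height addrK.
have d1 : n.1 - n'.1 != 0.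
  rewrite subr_eq0; apply: contra nn' => /eqP e.
  move: j0S; rewrite inE => /andP[/incP[_ e1] /incP[_]].
  rewrite -e e1 => /addIr e2.
  by rewrite (surjective_pairing n) (surjective_pairing n') e e2.
rewrite cardE -(size_map (fun j => (n.1 - (p j).1, n'.1 - (p j).1))).
apply: (card_at_most_size (diffI (n.2 - n'.2) d1)).
  rewrite map_inj_in_uniq ?enum_uniq // => i j.
  rewrite !mem_enum !finset.in_setI => /andP[/incP[_ i1] _] /andP[/incP[_ j1] _].
  move=> [/addrI/oppr_inj e _]; apply: p_inj.
  move: i1; rewrite e j1 => /addrI/oppr_inj e2.
  by rewrite (surjective_pairing (p i)) (surjective_pairing (p j)) e e2.
move=> v /mapP[j]; rewrite mem_enum finset.in_setI => /andP[/incP[I1 e1] /incP[I2 e2]].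
move=> -> /=; split=> //; first by ring.
by rewrite e1 e2; ring.
Qed.


Let blk (n : R * R) (k t : nat) : {set 'I_m} :=
  [set j in incident p n | k * t <= #|[set i in incident p n | bl n.1 i j]%SET| < k.+1 * t]%N%SET.

(** The curves strictly below [n] precede those through [n], and no other curve comes between; hence
    each block [blk n k t] fills a run of consecutive ranks, as the sweep demands. *)
Let inc_rk n j : j \in incident p n -> rk n.1 j =
  (#|[set i | defined_at (p i) n.1 && (height (p i) n.1 < n.2)%R]%SET| +
   #|[set i in incident p n | bl n.1 i j]%SET|)%N.
Proof.
move=> jJ; rewrite /rk -[LHS](cardsID (incident p n)) addnC; congr (_ + _)%N; last first.
  by apply: eq_card => i; rewrite !inE andbC.
apply: eq_card => i; rewrite !inE.
move: jJ; rewrite inE /bl /below => /andP[oj /eqP hj]; rewrite oj hj /=.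
by case: (defined_at (p i) n.1) => //=; case: (ltgtP (height (p i) n.1) n.2).
Qed.

(** Double counting: two distinct translates have at most [c] common points. *)
Lemma sum_inc_pairs (Q : seq (R * R)) : uniq Q ->
  (\sum_(n <- Q) #|incident p n| * #|incident p n|.-1 <= c * m ^ 2)%N.
Proof.
move=> uQ.
have E n : (#|incident p n| * #|incident p n|.-1 =
    \sum_(i < m) \sum_(j < m | j != i) ((i \in incident p n) && (j \in incident p n)))%N.
  rewrite [RHS](bigID (mem (incident p n))) /= [X in (_ + X)%N]big1 ?addn0; last first.
    by move=> i /negbTE iJ; apply: big1 => j _; rewrite iJ.
  rewrite (eq_bigr (fun _ => #|incident p n|.-1)) ?sum_nat_const // => i iJ.
  rewrite [#|incident p n|](cardsD1 i) iJ /= cardsE_sum [in LHS]big_mkcond /=.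
  by apply: eq_bigr => j _; rewrite !inE; case: (j != i); rewrite ?iJ.
rewrite (eq_bigr _ (fun n _ => E n)) exchange_big /=.
under eq_bigr do rewrite exchange_big /=.
apply: (@leq_trans (\sum_(i < m) \sum_(j < m) c)%N); last first.
  by rewrite !sum_nat_const !card_ord; lia.
apply: leq_sum => i _; rewrite big_mkcond /=; apply: leq_sum => j _.
case: ifP => // ji.
have -> : (\sum_(n <- Q) ((i \in incident p n) && (j \in incident p n)) =
    size [seq n <- Q | (i \in incident p n) && (j \in incident p n)])%N.
  by rewrite size_filter -sum1_count [RHS]big_mkcond.
set s := [seq n <- Q | _].
have sP n : n \in s -> [/\ I (n.1 - (p i).1), I (n.1 - (p j).1),
    psi (n.1 - (p i).1) = n.2 - (p i).2 & psi (n.1 - (p j).1) = n.2 - (p j).2].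
  rewrite mem_filter => /andP[/andP[]]; rewrite !inE.
  move=> /andP[/asboolP oi /eqP hi] /andP[/asboolP oj /eqP hj] _.
  split=> //; first by rewrite -hi /height addrK.
  by rewrite -[in RHS]hj /height addrK.
have [->//|[n0 n0s]] : s = [::] \/ exists n, n \in s.
  by case: (s) => [|n s']; [left|right; exists n; rewrite mem_head].
have d1 : (p j).1 - (p i).1 != 0.
  rewrite subr_eq0; apply/negP => /eqP e; move/negP: ji; apply.
  have [_ _ hi hj] := sP _ n0s; apply/eqP/p_inj.
  move: hj; rewrite e hi => /addrI/oppr_inj e2.
  by rewrite (surjective_pairing (p i)) (surjective_pairing (p j)) e e2.
rewrite -(size_map (fun n => (n.1 - (p i).1, n.1 - (p j).1))).
apply: (card_at_most_size (diffI ((p j).2 - (p i).2) d1)).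
  rewrite map_inj_in_uniq ?filter_uniq // => n n' /sP[_ _ h _] /sP[_ _ h' _].
  move=> [/addIr e _]; move: h; rewrite e h' => /addIr e2.
  by rewrite (surjective_pairing n) (surjective_pairing n') e e2.
move=> v /mapP[n /sP[I1 I2 h1 h2]] -> /=.
by split=> //; [ring|rewrite h1 h2; ring].
Qed.

(** The sweep visits the blocks of all points in order of abscissa. A point may be visited several
    times, because its blocks are disjoint; blocks of different points share at most [c] curves. *)
Lemma sum_blocks_bound (Q : seq (R * R)) (t : nat) : uniq Q -> (0 < c)%N ->
  (16 * c <= t)%N ->
  ((\sum_(n <- Q) #|incident p n| %/ t) * t ^ 3 <=
   1024 * c * (c + 2) * m ^ 2 + 160 * m * t ^ 2)%N.
Proof.
move=> uQ c_gt0 ct; have t_gt0 : (0 < t)%N by lia.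
pose le1 (a b : R * R * nat) := a.1.1 <= b.1.1.
pose L0 := [seq (n, k) | n <- Q, k <- iota 0 (#|incident p n| %/ t)].
pose L := sort le1 L0.
pose q := size L; pose d : R * R * nat := ((0, 0), 0%N).
have L_uniq : uniq L.
  rewrite sort_uniq; apply: allpairs_uniq_dep => //; first by move=> n _; exact: iota_uniq.
  by move=> [a b] [a' b'] _ _ [-> ->].
have le1_total : total le1 by move=> a b; exact: le_total.
have le1_trans : transitive le1 by move=> a b e; exact: le_trans.
have L_sorted : sorted le1 L by exact: sort_sorted.
have LP l : (l < q)%N -> ((nth d L l).2 < #|incident p (nth d L l).1| %/ t)%N.
  move=> lq; have : nth d L l \in L by exact: mem_nth.
  rewrite mem_sort => /allpairsPdep[n [k [_]]].
  by rewrite mem_iota => /andP[_ kn] -> /=.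
pose pt l := (nth d L l).1; pose ix l := (nth d L l).2.
(* The sweep also reads the ranking at time [q]; the minimum repeats the last abscissa there. *)
pose x l := (pt (minn l q.-1)).1.
have x_homo : {homo x : l l' / (l <= l')%N >-> l <= l'}.
  move=> l l' ll'; rewrite /x /pt.
  have [q0|q_gt0] := posnP q; first by rewrite !(minn_idPr _) ?q0.
  apply: (sorted_leq_nth le1_trans (fun a => lexx a.1.1) d L_sorted);
    rewrite ?inE -/q; lia.
have x_pt l : (l < q)%N -> x l = (pt l).1 by move=> lq; rewrite /x (minn_idPl _) //; lia.
have q_sum : q = (\sum_(n <- Q) #|incident p n| %/ t)%N.
  rewrite /q size_sort size_allpairs_dep sumnE big_map.
  by apply: eq_bigr => n _; rewrite size_iota.
rewrite -q_sum.
have := @sweep_bound 'I_m q (fun l => rk (x l)) (fun l => blk (pt l) (ix l) t)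
  (fun l => #|[set i | defined_at (p i) (pt l).1 && (height (p i) (pt l).1 < (pt l).2)%R]%SET| +
     ix l * t)%N t c (fun l => @rk_inj (x l)) (fun l => rk_lt (x l)) t_gt0.
move=> H; have {}H := H _ _ _ c_gt0 ct.
have := moves_bound q x_homo; rewrite card_ord in H *.
move=> mv; apply: (leq_trans (H _ _ _)).
- move=> l lq; rewrite /blk.
  have := @leq_card_between _ (incident p (pt l))
    (fun j => #|[set i in incident p (pt l) | bl (pt l).1 i j]%SET|)
    (ix l * t) ((ix l).+1 * t) (@rk_inj_in _ _).
  have -> : ((ix l).+1 * t - ix l * t = t)%N by lia.
  apply.
    move=> j jJ; apply: proper_card; apply/properP; split.
      by apply/fintype.subsetP => i; rewrite inE => /andP[].
    by exists j => //; rewrite inE jJ bl_irr.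
  by apply: leq_trans (leq_trunc_div _ t); rewrite leq_mul2r LP ?orbT.
- move=> l j lq; rewrite inE => /andP[jJ] H1.
  by rewrite (x_pt _ lq) (inc_rk jJ); move: H1; rewrite mulSn; lia.
- move=> l l' lq lq' ll'.
  have : nth d L l != nth d L l' by rewrite nth_uniq.
  rewrite (surjective_pairing (nth d L l)) (surjective_pairing (nth d L l')).
  rewrite -/(pt l) -/(pt l') -/(ix l) -/(ix l') xpair_eqE negb_and.
  have [e /= ixll'|ne _] := eqVneq (pt l) (pt l'); last first.
    apply: leq_trans (card_incI ne); apply: subset_leq_card.
    by apply: finset.setISS; apply/fintype.subsetP => j; rewrite inE => /andP[].
  apply: (@leq_trans 0) => //; rewrite e leqn0 cards_eq0.
  apply/eqP/setP => j; rewrite !inE; apply/negP.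
  move=> /andP[/andP[_ /andP[a1 a2]] /andP[_ /andP[b1 b2]]].
  have : (ix l < (ix l').+1)%N by rewrite -(ltn_pmul2r t_gt0); lia.
  have : (ix l' < (ix l).+1)%N by rewrite -(ltn_pmul2r t_gt0); lia.
  lia.
by rewrite leq_add2r; apply: leq_trans (leq_mul (leqnn _) mv) _; lia.
Qed.

Lemma incidence_bound (Q : seq (R * R)) (t : nat) : uniq Q -> (0 < c)%N ->
  (2 <= t)%N ->
  ((\sum_(n <- Q) #|incident p n|) * t ^ 2 <=
   t ^ 3 * size Q + 2 ^ 13 * c ^ 4 * (m ^ 2 + m * t ^ 2))%N.
Proof.
move=> uQ c_gt0 t2; have t_gt0 : (0 < t)%N by lia.
set q := (\sum_(n <- Q) #|incident p n| %/ t)%N.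
have Iq : (\sum_(n <- Q) #|incident p n| <= t * q + t * size Q)%N.
  rewrite [(t * q)%N]mulnC big_distrl /= -sum1_size big_distrr /= -big_split.
  apply: leq_sum => n _ /=.
  by have := divn_eq #|incident p n| t; have := ltn_pmod #|incident p n| t_gt0; lia.
suff : (q * t ^ 3 <= 2 ^ 13 * c ^ 4 * (m ^ 2 + m * t ^ 2))%N.
  by have := leq_mul (leqnn (t ^ 2)) Iq; lia.
have c4 : (c <= c ^ 4)%N by rewrite -[leqLHS]expn1 leq_pexp2l.
have c24 : (c ^ 2 <= c ^ 4)%N by rewrite leq_pexp2l.
have [ct|tc] := leqP (16 * c) t.
  apply: leq_trans (sum_blocks_bound uQ c_gt0 ct) _.
  rewrite [leqRHS]mulnDr; apply: leq_add.
    by rewrite leq_mul2r; apply/orP; right; lia.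
  by rewrite mulnA leq_mul2r; apply/orP; right; rewrite leq_mul2r; lia.
have q_le : (q <= c * m ^ 2)%N.
  apply: leq_trans (sum_inc_pairs uQ); apply: leq_sum => n _.
  case: #|incident p n| => [|i]; first by rewrite div0n.
  apply: (@leq_trans (i.+1 %/ 2)); first exact: leq_div2l.
  by case: i => // i; rewrite (leq_trans (leq_div _ _)) ?leq_pmulr.
have t3 : (t ^ 3 <= 16 ^ 3 * c ^ 3)%N by rewrite -expnMn leq_exp2r // ltnW.
have := leq_mul q_le t3; lia.
Qed.

End Incidences.
End Curves.

(** * Weighted incidences *)

Definition reps (T : finType) (V : eqType) (f : T -> V) (v : V) : nat :=
  #|[pred t | f t == v]|.

(** Summing over [T] counts each value [v] another [reps f v] times, so this is the usual additive
    energy, the sum of the squares of [reps f]. *)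
Definition energy (T : finType) (V : eqType) (f : T -> V) : nat :=
  (\sum_t reps f (f t))%N.

Definition image_seq (T : finType) (V : eqType) (f : T -> V) : seq V :=
  undup (codom f).

Lemma mem_image_seq (T : finType) (V : eqType) (f : T -> V) (v : V) :
  (v \in image_seq f) = (0 < reps f v)%N.
Proof.
rewrite mem_undup; apply/codomP/card_gt0P => [[t ->]|[t]].
  by exists t; rewrite inE.
by rewrite inE => /eqP <-; exists t.
Qed.

Lemma sum_reps (R : pzSemiRingType) (T : finType) (V : eqType) (f : T -> V)
    (S : seq V) (G : V -> R) :
  uniq S -> (forall t, f t \in S) ->
  \sum_t G (f t) = \sum_(v <- S) (reps f v)%:R * G v.
Proof.
move=> uS fS.
transitivity (\sum_t \sum_(v <- S) (if f t == v then G v else 0)).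
  apply: eq_bigr => t _; rewrite (bigD1_seq (f t)) //= eqxx.
  by rewrite big1 ?addr0 // => v /negbTE; rewrite eq_sym => ->.
rewrite exchange_big; apply: eq_bigr => v _ /=.
by rewrite -big_mkcond sumr_const mulr_natl.
Qed.

Lemma sum_nat_reps (T : finType) (V : eqType) (f : T -> V)
    (S : seq V) (G : V -> nat) :
  uniq S -> (forall t, f t \in S) ->
  (\sum_t G (f t) = \sum_(v <- S) reps f v * G v)%N.
Proof.
move=> uS fS; have := @sum_reps nat T V f S G uS fS.
by under [RHS]eq_bigr do rewrite natn.
Qed.

Section Weighted.
Variables (R : realType) (V : zmodType) (U : finType) (P : U -> V) (K c : nat).

(* The Szemeredi-Trotter bound for the translates of [P] by points of [M]; the
   optimal choice of [t] is [(size M ^ 2 / size Q) ^ (1 / 3)]. *)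
Definition few_incidences : Prop := forall (M Q : seq V) (t : nat),
  uniq M -> uniq Q -> (2 <= t)%N ->
  ((\sum_(n <- Q) \sum_u (((n - P u)%R \in M) : nat)) * t ^ 2 <=
   t ^ 3 * size Q + K * (size M ^ 2 + size M * t ^ 2))%N.

Hypothesis st : few_incidences.

(** As (x - y)(x + y) = 1, the difference of the values of z/(a + z) at [x] and [y] equals a / ((x +
    y)(a + x)(a + y)); then y < x and (a + x)^4 <= 8 (a^4 + x^4) are used. The two terms of the
    bound will be matched with the second and the first moment of a weight. *)
Lemma inv_weight_bound (a x y : R) : 0 < a -> 0 <= y -> x ^+ 2 = y ^+ 2 + 1 ->
  0 < x ->
  let rho := (x / (a + x) - y / (a + y)) / 4 in
  0 < rho /\ rho ^- 2 <= 512 * (x ^+ 2 * a ^+ 2 + x ^+ 6 / a ^+ 2).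
Proof.
move=> a0 y0 xy x0 rho.
have yx : y < x by nra.
have rhoE : rho = a / (4 * ((x + y) * ((a + x) * (a + y)))).
  have -> : rho = (a * (x - y) * (x + y)) / (4 * ((x + y) * ((a + x) * (a + y)))).
    by rewrite /rho; field; rewrite !gt_eqF //; lra.
  by congr (_ / _); rewrite -mulrA -subr_sqr xy; ring.
have den_le : 4 * ((x + y) * ((a + x) * (a + y))) <= 8 * x * (a + x) ^+ 2.
  have : (x + y) * ((a + x) * (a + y)) <= (2 * x) * ((a + x) * (a + x)).
    by apply: ler_pM; nra.
  lra.
have den_gt0 : 0 < 4 * ((x + y) * ((a + x) * (a + y))).
  by rewrite !mulr_gt0 //; lra.
split; first by rewrite rhoE divr_gt0.
have -> : 512 * (x ^+ 2 * a ^+ 2 + x ^+ 6 / a ^+ 2) =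
    (64 * x ^+ 2 * (8 * (a ^+ 4 + x ^+ 4))) / a ^+ 2.
  by field; rewrite gt_eqF.
rewrite rhoE expr_div_n invf_div ler_pM2r ?invr_gt0 ?exprn_gt0 //.
apply: (@le_trans _ _ ((8 * x * (a + x) ^+ 2) ^+ 2)).
  by rewrite ler_sqr ?nnegrE // ltW // (lt_le_trans den_gt0).
have -> : (8 * x * (a + x) ^+ 2) ^+ 2 = 64 * x ^+ 2 * ((a + x) ^+ 2) ^+ 2 by ring.
rewrite ler_pM2l; last by rewrite mulr_gt0 ?exprn_gt0.
have h1 : (a + x) ^+ 2 <= 2 * (a ^+ 2 + x ^+ 2).
  by have := sqr_ge0 (a - x); lra.
have h2 : ((a + x) ^+ 2) ^+ 2 <= (2 * (a ^+ 2 + x ^+ 2)) ^+ 2.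
  by rewrite ler_sqr ?nnegrE ?sqr_ge0 // (le_trans (sqr_ge0 _) h1).
apply: (le_trans h2).
have : 0 <= (a ^+ 2 - x ^+ 2) ^+ 2 by exact: sqr_ge0.
lra.
Qed.

(** * Level sets of a convolution with [P] *)

Section Level.
Variables (T : finType) (f : T -> V).

Definition add_point (tu : T * U) : V := f tu.1 + P tu.2.

Lemma reps_add_point n :
  reps add_point n = (\sum_u reps f (n - P u)%R)%N.
Proof.
rewrite /reps -sum1_card big_mkcond /=.
rewrite (eq_bigr (fun tu : T * U => (f tu.1 == n - P tu.2) : nat)); last first.
  by move=> [t u] _; rewrite !inE /add_point /= eq_sym -subr_eq eq_sym; case: eqP.
rewrite -(pair_bigA _ (fun t u => (f t == n - P u) : nat)) exchange_big /=.
apply: eq_bigr => u _; rewrite -sum1_card [RHS]big_mkcond.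
by apply: eq_bigr => t _; rewrite inE; case: eqP.
Qed.

Let S := image_seq f.
Let w := reps f.
Let M k := [seq v <- S | (k <= w v)%N].

Let S_uniq : uniq S. Proof. exact: undup_uniq. Qed.
Let f_in_S t : f t \in S. Proof. by rewrite mem_undup codom_f. Qed.

Let sum_w : (\sum_(v <- S) w v = #|T|)%N.
Proof.
have := sum_nat_reps (fun=> 1%N) S_uniq f_in_S.
by rewrite sum1_card => ->; apply: eq_bigr => v _; rewrite muln1.
Qed.

Let sum_w2 : (\sum_(v <- S) w v ^ 2 = energy f)%N.
Proof.
rewrite /energy (sum_nat_reps (reps f) S_uniq f_in_S).
by apply: eq_bigr => v _; rewrite mulnn.
Qed.

Let sizeM k : size (M k) = (\sum_(v <- S) (k <= w v))%N.
Proof. by rewrite size_filter -sum1_count big_mkcond. Qed.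

Let M_W1 k : (k * size (M k) <= #|T|)%N.
Proof.
rewrite sizeM -sum_w big_distrr; apply: leq_sum => v _ /=.
by case: (leqP k (w v)); lia.
Qed.

Let M_W2 k : (k ^ 2 * size (M k) <= energy f)%N.
Proof.
rewrite sizeM -sum_w2 big_distrr; apply: leq_sum => v _ /=.
by case: (leqP k (w v)) => h; rewrite /= ?muln0 // muln1 leq_exp2r.
Qed.

Let sum_le_w (b x : nat) : (\sum_(0 <= k < b) (k < x) = minn b x)%N.
Proof.
elim: b => [|b IH]; first by rewrite big_geq // min0n.
by rewrite big_nat_recr //= IH; case: leqP; lia.
Qed.

Let sum_le_w2 (b x : nat) : (\sum_(0 <= k < b) k.+1 * (k < x) <= minn b x ^ 2)%N.
Proof.
elim: b => [|b IH]; first by rewrite big_geq.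
rewrite big_nat_recr //=; case: (ltnP b x) => bx; last first.
  by rewrite muln0 addn0; move: IH; rewrite !(minn_idPr _) //; lia.
by move: IH; rewrite !(minn_idPl _) //; lia.
Qed.

Let sum_M_W1 b : (\sum_(0 <= k < b) size (M k.+1) <= #|T|)%N.
Proof.
under eq_bigr do rewrite sizeM; rewrite exchange_big -sum_w /=.
by apply: leq_sum => v _; rewrite sum_le_w geq_minr.
Qed.

Let sum_M_W2 b : (\sum_(0 <= k < b) k.+1 * size (M k.+1) <= energy f)%N.
Proof.
under eq_bigr do rewrite sizeM big_distrr; rewrite exchange_big -sum_w2 /=.
apply: leq_sum => v _; apply: leq_trans (sum_le_w2 _ _) _.
by rewrite leq_exp2r // geq_minr.
Qed.

(** Such an [n] is determined by [u] and a value of multiplicity at least tau/8, and at most 64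
    energy / tau^2 values are that frequent. *)
Lemma heavy_level_bound (Q : seq V) (tau : nat) : uniq Q ->
  (forall n, n \in Q -> exists u, tau <= 8 * reps f (n - P u)%R)%N ->
  (size Q * tau ^ 2 <= 64 * #|U| * energy f)%N.
Proof.
move=> uQ QH; have [->//|tau_gt0] := posnP tau.
  by rewrite muln0.
pose H := [seq v <- S | (tau <= 8 * w v)%N].
have QHU : (size Q <= #|U| * size H)%N.
  have -> : (#|U| * size H = size [seq (v + P u)%R | v <- H, u <- enum U])%N.
    by rewrite size_allpairs -cardE mulnC.
  apply: uniq_leq_size => // n /QH[u hu]; apply/allpairsP.
  exists (n - P u, u); split=> /=; [|by rewrite mem_enum|by rewrite subrK].
  by rewrite mem_filter hu mem_image_seq lt0n; apply/eqP => e; move: hu; rewrite e muln0; lia.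
have HW : (size H * tau ^ 2 <= 64 * energy f)%N.
  rewrite -sum1_size big_distrl /= big_filter big_mkcond -sum_w2 big_distrr /=.
  apply: leq_sum => v _; case: ifP => // h.
  by rewrite mul1n -[64%N]/(8 ^ 2)%N -expnMn leq_exp2r.
by have := leq_mul QHU (leqnn (tau ^ 2)); have := leq_mul (leqnn #|U|) HW; lia.
Qed.

(** [reps add_point n] is a sum over the layers [M k.+1] of the weight. Layers below [k1] contribute
    at most tau/4, layers from [k2] on nothing, so the incidences [I k] of [Q] with the remaining
    layers add up to at least 3/4 tau |Q|. The incidence bound is applied layer by layer. *)
Lemma light_level_bound (Q : seq V) (tau : nat) : uniq Q ->
  (0 < #|U|)%N -> (0 < tau)%N ->
  (forall n, n \in Q -> tau <= reps add_point n)%N ->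
  (forall n u, n \in Q -> 8 * reps f (n - P u)%R < tau)%N ->
  (size Q * tau ^ 3 <=
   4 * K * (1024 * #|T| + 4 * #|U| * tau) * energy f)%N.
Proof.
move=> uQ N_gt0 tau_gt0 Qrich Qlight.
pose N := #|U|; pose k1 := (tau %/ (4 * N))%N; pose k2 := (tau %/ 8)%N.
pose I k := (\sum_(n <- Q) \sum_u ((n - P u)%R \in M k.+1 : nat))%N.
have k1N : (4 * N * k1 <= tau)%N by rewrite mulnC leq_trunc_div.
have k2_8 : (8 * k2 <= tau)%N by rewrite mulnC leq_trunc_div.
have layers : (3 * tau * size Q <= 4 * \sum_(k1 <= k < k2) I k)%N.
  have H1 : (tau * size Q <= \sum_(n <- Q) reps add_point n)%N.
    rewrite -sum1_size big_distrr /= big_seq [leqRHS]big_seq.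
    by apply: leq_sum => n nQ; rewrite muln1 Qrich.
  have H2 : (\sum_(n <- Q) reps add_point n <=
      size Q * (N * k1) + \sum_(k1 <= k < k2) I k)%N.
    rewrite /I exchange_big /= -sum1_size big_distrl /= -big_split /=.
    rewrite big_seq [leqRHS]big_seq; apply: leq_sum => n nQ.
    rewrite reps_add_point exchange_big mul1n /= -sum_nat_const -big_split /=.
    apply: leq_sum => u _; rewrite -/(w _).
    have wk2 : (w (n - P u)%R <= k2)%N.
      by rewrite leq_divRL //; have := Qlight _ u nQ; rewrite -/w; lia.
    under eq_bigr do rewrite mem_filter mem_image_seq -/(w _).
    move: (w _) wk2 => x xk2.
    apply: (@leq_trans (k1 + \sum_(k1 <= k < k2) (k < x))%N); last first.
      by rewrite leq_add2l; apply: leq_sum => k _; case: ltnP => //; lia.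
    have [k12|k21] := leqP k1 k2; last lia.
    have := sum_le_w k2 x; rewrite (minn_idPr xk2) (big_cat_nat (leq0n k1)) //=.
    have := sum_le_w k1 x; have := geq_minl k1 x; lia.
  have H3 : (4 * (size Q * (N * k1)) <= tau * size Q)%N.
    by have := leq_mul k1N (leqnn (size Q)); lia.
  lia.
pose W1 : R := #|T|%:R; pose W2 : R := (energy f)%:R.
have [T0|T_gt0] := posnP #|T|.
  have -> : Q = [::]; last by [].
  case: Q Qrich {uQ Qlight I layers} => // n Q' /(_ n (mem_head _ _)).
  rewrite leqNgt => /negP[]; apply: leq_ltn_trans tau_gt0.
  by rewrite leqn0 -leqn0; apply: leq_trans (max_card _) _; rewrite card_prod T0.
have W1_gt0 : 0 < W1 by rewrite ltr0n.
have W2_gt0 : 0 < W2.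
  rewrite ltr0n; case/card_gt0P: (T_gt0) => t0 _.
  rewrite /energy (bigD1 t0) //= ltn_addr //.
  by rewrite -mem_image_seq f_in_S.
(* The level [k] is treated with incidence parameter about [tau * rho k]: the
   [rho k] telescope to at most [1 / 4], and are largest near the mean weight
   [a ^+ 2 = W2 / W1]. *)
pose a := Num.sqrt (W2 / W1); pose x k : R := Num.sqrt k%:R.
have a_gt0 : 0 < a by rewrite sqrtr_gt0 divr_gt0.
have a2 : a ^+ 2 = W2 / W1 by rewrite sqr_sqrtr // ltW // divr_gt0.
have x2 k : x k ^+ 2 = k%:R by rewrite sqr_sqrtr.
pose rho k : R := (x k.+1 / (a + x k.+1) - x k / (a + x k)) / 4.
have rhoP k : 0 < rho k /\ rho k ^- 2 <= 512 * (k.+1%:R * (W2 / W1) + k.+1%:R ^+ 3 / (W2 / W1)).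
  have x6 : x k.+1 ^+ 6 = k.+1%:R ^+ 3 by rewrite -x2 -exprM.
  have x_gt0 : 0 < x k.+1 by rewrite sqrtr_gt0 ltr0n.
  have xk : x k.+1 ^+ 2 = x k ^+ 2 + 1 by rewrite !x2 natr1.
  have [r0 r2] := inv_weight_bound a_gt0 (sqrtr_ge0 _) xk x_gt0.
  by split=> //; move: r2; rewrite x6 x2 a2.
pose t k := (2 + Num.trunc (tau%:R * rho k))%N.
have t_ge k : tau%:R * rho k <= (t k)%:R.
  by rewrite /t; have := truncnS_gt (tau%:R * rho k); rewrite -addn2 addnC !natrD; lra.
have t_le k : (t k)%:R <= 2 + tau%:R * rho k.
  by rewrite /t natrD lerD2l truncn_le mulr_ge0 // ltW // (rhoP k).1.
have t2 k : (2 <= t k)%N by exact: leq_addr.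
clearbody t.
have sum_rho : \sum_(k1 <= k < k2) rho k <= 1 / 4.
  have [k12|k21] := leqP k1 k2; last by rewrite big_geq ?(ltnW k21) //; lra.
  pose th k := x k / (a + x k).
  rewrite -big_distrl /= (telescope_sumr th k12) -/th.
  rewrite ler_pM2r ?invr_gt0 //.
  have th_ge0 : 0 <= th k1 by rewrite divr_ge0 ?sqrtr_ge0 ?addr_ge0 ?sqrtr_ge0.
  have th_le1 : th k2 <= 1.
    by rewrite ler_pdivrMr ?ltr_wpDr ?sqrtr_ge0 //; have := ltW a_gt0; lra.
  by lra.
have I_le k : (I k)%:R <= (t k)%:R * (size Q)%:R +
    K%:R * ((size (M k.+1))%:R ^+ 2 / (t k)%:R ^+ 2 + (size (M k.+1))%:R) :> R.
  move: (t k) (t2 k) => y y2.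
  have := @st (M k.+1) Q y (filter_uniq _ S_uniq) uQ y2.
  rewrite -/(I k) -(ler_nat R) !(natrD, natrM, natrX) => H.
  have y0 : 0 < y%:R :> R by rewrite ltr0n; lia.
  rewrite -(ler_pM2r (exprn_gt0 2 y0)); apply: (le_trans H).
  rewrite le_eqVlt; apply/orP; left; apply/eqP; field.
  by rewrite gt_eqF.
(* One factor |M| is traded for a moment: (k+1) |M| <= W1 in the term with a^2, (k+1)^2 |M| <= W2 in
   the term with 1/a^2. The choice a^2 = W2/W1 makes both contribute W1 W2 after summation over
   [k]. *)
have terms k : (size (M k.+1))%:R ^+ 2 / (t k)%:R ^+ 2 <=
    512 / tau%:R ^+ 2 * (W2 * (size (M k.+1))%:R +
                         W1 * (k.+1 * size (M k.+1))%:R).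
  have [] := rhoP k; set s := size _.
  move: (rho k) (t_ge k) => r tr r0 r2.
  have tau0 : 0 < tau%:R :> R by rewrite ltr0n.
  apply: (@le_trans _ _ (s%:R ^+ 2 / (tau%:R * r) ^+ 2)).
    have tr0 := mulr_gt0 tau0 r0; have t0 := lt_le_trans tr0 tr.
    rewrite ler_wpM2l ?sqr_ge0 // lef_pV2 ?posrE ?exprn_gt0 //.
    by rewrite ler_sqr ?nnegrE ?(ltW tr0) ?(ltW t0).
  have sW1 : k.+1%:R * s%:R <= W1 by rewrite -natrM ler_nat M_W1.
  have sW2 : k.+1%:R ^+ 2 * s%:R <= W2 by rewrite -natrX -natrM ler_nat M_W2.
  have -> : s%:R ^+ 2 / (tau%:R * r) ^+ 2 = s%:R ^+ 2 * r ^- 2 / tau%:R ^+ 2.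
    by field; rewrite !gt_eqF.
  rewrite [leRHS]mulrAC ler_pM2r ?invr_gt0 ?exprn_gt0 // natrM.
  apply: (le_trans (ler_wpM2l (sqr_ge0 _) r2)).
  have s0 : 0 <= s%:R :> R by [].
  have k0 : 0 <= k.+1%:R :> R by [].
  have e1 : s%:R ^+ 2 * (k.+1%:R * (W2 / W1)) <= W2 * s%:R.
    have -> : s%:R ^+ 2 * (k.+1%:R * (W2 / W1)) = (k.+1%:R * s%:R) * (W2 * s%:R / W1).
      by field; rewrite gt_eqF.
    apply: (le_trans (ler_wpM2r _ sW1)).
      by rewrite divr_ge0 ?mulr_ge0 ?(ltW W1_gt0) ?(ltW W2_gt0).
    rewrite le_eqVlt; apply/orP; left; apply/eqP; field.
    by rewrite gt_eqF.
  have e2 : s%:R ^+ 2 * (k.+1%:R ^+ 3 / (W2 / W1)) <= W1 * (k.+1%:R * s%:R).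
    have -> : s%:R ^+ 2 * (k.+1%:R ^+ 3 / (W2 / W1)) =
        (k.+1%:R ^+ 2 * s%:R) * (W1 * (k.+1%:R * s%:R) / W2).
      by field; rewrite !gt_eqF.
    apply: (le_trans (ler_wpM2r _ sW2)).
      by rewrite divr_ge0 ?mulr_ge0 ?(ltW W1_gt0) ?(ltW W2_gt0).
    rewrite le_eqVlt; apply/orP; left; apply/eqP; field.
    by rewrite gt_eqF.
  by lra.
have tail_sum (F : nat -> nat) :
    (\sum_(k1 <= k < k2) F k <= \sum_(0 <= k < k2) F k)%N.
  have [k12|k21] := leqP k1 k2; last by rewrite big_geq // ltnW.
  by rewrite [leqRHS](big_cat_nat (leq0n k1)) //= leq_addl.
pose mu k : R := (size (M k.+1))%:R.
have sum_mu1 : \sum_(k1 <= k < k2) mu k <= W1.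
  by rewrite -natr_sum ler_nat (leq_trans (tail_sum _)).
have sum_mu2 : \sum_(k1 <= k < k2) (k.+1 * size (M k.+1))%:R <= W2.
  by rewrite -natr_sum ler_nat (leq_trans (tail_sum _)).
have tau0 : 0 < tau%:R :> R by rewrite ltr0n.
(* The lower cut-off is used here: k >= k1 gives tau < 4 N (k + 1). *)
have Y_le : tau%:R * (\sum_(k1 <= k < k2) mu k) <= 4 * N%:R * W2.
  apply: (@le_trans _ _ (4 * N%:R * \sum_(k1 <= k < k2) (k.+1 * size (M k.+1))%:R)).
    rewrite !big_distrr /= big_nat [leRHS]big_nat; apply: ler_sum => k /andP[k1k _].
    rewrite /mu -!natrM ler_nat mulnA leq_mul2r; apply/orP; right.
    have N4 : (0 < 4 * N)%N by rewrite muln_gt0.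
    rewrite ltnW // [X in (_ < X)%N]mulnC -ltn_divLR //.
  by rewrite ler_wpM2l // mulr_ge0.
have X_le : tau%:R ^+ 2 * (\sum_(k1 <= k < k2) mu k ^+ 2 / (t k)%:R ^+ 2) <=
    1024 * W1 * W2.
  apply: (@le_trans _ _ (512 * (W2 * (\sum_(k1 <= k < k2) mu k) +
      W1 * \sum_(k1 <= k < k2) (k.+1 * size (M k.+1))%:R))).
    rewrite (big_distrr W2) (big_distrr W1) -big_split /= !big_distrr /=.
    apply: ler_sum => k _; rewrite mulrC -ler_pdivlMr ?exprn_gt0 //.
    by apply: (le_trans (terms k)); rewrite mulrAC.
  have h1 := ler_wpM2l (ltW W2_gt0) sum_mu1.
  have h2 := ler_wpM2l (ltW W1_gt0) sum_mu2.
  lra.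
(* The summands 2 add up to at most tau/4, and so do the tau rho k. Hence the terms t |Q| use up
   only 1/2 of the 3/4 tau |Q| found in [layers]. *)
have t_sum : \sum_(k1 <= k < k2) (t k)%:R <= tau%:R / 2 :> R.
  apply: (@le_trans _ _ (\sum_(k1 <= k < k2) (2 + tau%:R * rho k))).
    by apply: ler_sum => k _; exact: t_le.
  rewrite big_split /= -big_distrr /= sumr_const_nat -mulr_natr.
  have h : (k2 - k1)%:R * 8 <= tau%:R :> R.
    rewrite -natrM ler_nat; apply: leq_trans k2_8.
    by rewrite mulnC leq_mul2l leq_subr orbT.
  have := ler_wpM2l (ltW tau0) sum_rho; lra.
have I_sum : \sum_(k1 <= k < k2) (I k)%:R <=
    tau%:R / 2 * (size Q)%:R + K%:R *
     (\sum_(k1 <= k < k2) mu k ^+ 2 / (t k)%:R ^+ 2 + \sum_(k1 <= k < k2) mu k) :> R.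
  apply: (@le_trans _ _ (\sum_(k1 <= k < k2) ((t k)%:R * (size Q)%:R +
     K%:R * (mu k ^+ 2 / (t k)%:R ^+ 2 + mu k)))).
    by apply: ler_sum => k _; exact: I_le.
  rewrite big_split /= -big_distrl -big_distrr /= big_split /=.
  by rewrite lerD2r ler_wpM2r.
set X := \sum_(k1 <= k < k2) mu k ^+ 2 / (t k)%:R ^+ 2 in X_le I_sum.
set Y := \sum_(k1 <= k < k2) mu k in Y_le I_sum.
have : (3 * tau * size Q)%:R <= (4 * \sum_(k1 <= k < k2) I k)%:R :> R by rewrite ler_nat.
rewrite !natrM natr_sum => lay.
have main : tau%:R * (size Q)%:R <= 4 * K%:R * (X + Y) by lra.
rewrite -(ler_nat R) natrM natrX !natrM natrD !natrM -/W1 -/W2 -/N.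
have -> : (size Q)%:R * tau%:R ^+ 3 = tau%:R ^+ 2 * (tau%:R * (size Q)%:R) :> R by ring.
apply: (le_trans (ler_wpM2l (sqr_ge0 _) main)).
have K0 : 0 <= 4 * K%:R :> R by rewrite mulr_ge0.
rewrite mulrCA -!mulrA; rewrite [leLHS]mulrA [leRHS]mulrA; apply: ler_wpM2l => //.
have := ler_wpM2l (ltW tau0) Y_le; lra.
Qed.

(** The hypothesis on [tau] turns the factors |U| tau of the heavy and the light case into c |T|.
    For nonempty [Q] it will follow from an upper bound for [reps (add_point P f)]. *)
Lemma level_bound (Q : seq V) (tau : nat) : uniq Q -> (0 < #|U|)%N ->
  (forall n, n \in Q -> tau <= reps add_point n)%N ->
  (#|U| * tau <= c * #|T|)%N ->
  (size Q * tau ^ 3 <=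
   (64 * c + 4 * K * (1024 + 4 * c)) * #|T| * energy f)%N.
Proof.
move=> uQ N_gt0 Qrich cT; have [->|tau_gt0] := posnP tau.
  by rewrite muln0.
pose heavy n := [exists u, (tau <= 8 * reps f (n - P u)%R)%N].
have hvy : (size [seq n <- Q | heavy n] * tau ^ 2 <= 64 * #|U| * energy f)%N.
  apply: heavy_level_bound; first exact: filter_uniq.
  by move=> n; rewrite mem_filter => /andP[/existsP].
have -> : size Q = (size [seq n <- Q | heavy n] + size [seq n <- Q | ~~ heavy n])%N.
  by rewrite !size_filter count_predC.
rewrite mulnDl -mulnA mulnDl; apply: leq_add.
  rewrite expnSr mulnA.
  apply: (@leq_trans (64 * #|U| * energy f * tau)).
    by rewrite leq_mul2r hvy orbT.
  by have := leq_mul (leqnn (64 * energy f)) cT; lia.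
apply: (leq_trans (light_level_bound (filter_uniq _ uQ) N_gt0 tau_gt0 _ _)).
- by move=> n; rewrite mem_filter => /andP[_]; exact: Qrich.
- by move=> n u; rewrite mem_filter ltnNge => /andP[/existsPn/(_ u)].
by have := leq_mul (leqnn (16 * K * energy f)) cT; lia.
Qed.

End Level.
End Weighted.

(** * Moments of convolutions *)

Section Moments.
Variables (R : realType) (X : eqType) (S : seq X) (r : X -> nat) (B : nat) (Bd : R).
Hypothesis r_le : forall n, n \in S -> (r n <= B)%N.
Hypothesis level : forall tau, (size [seq n <- S | (tau <= r n)%N])%:R * tau%:R ^+ 3 <= Bd.

(** x^2 is the sum of 2k+1 over k < x; the layers below [T0] are replaced by the linear term. *)
Lemma square_layers (T0 x : nat) : (x <= B)%N ->
  (x ^ 2 <= T0 * x + \sum_(T0 <= k < B) 2 * k.+1 * (k < x))%N.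
Proof.
move=> xB; have [xT|Tx] := leqP x T0.
  by apply: leq_trans (leq_addr _ _); rewrite -mulnn leq_mul2r xT orbT.
rewrite (big_cat_nat (ltnW Tx) xB) /= addnA.
apply: leq_trans (leq_addr _ _).
have : (\sum_(T0 <= k < x) 2 * k.+1 * (k < x) = \sum_(T0 <= k < x) 2 * k.+1)%N.
  by apply: eq_big_nat => k /andP[_ ->]; rewrite muln1.
move=> ->; have := ltnW Tx; elim: {Tx xB} x => [|x IH]; first lia.
rewrite leq_eqVlt => /orP[/eqP->|]; first by rewrite big_geq //; lia.
by rewrite ltnS => Tx; rewrite big_nat_recr //=; have := IH Tx; lia.
Qed.

Lemma cube_layers (T0 x : nat) : (x <= B)%N ->
  (x ^ 3 <= T0 ^ 2 * x + \sum_(T0 <= k < B) 3 * k.+1 ^ 2 * (k < x))%N.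
Proof.
move=> xB; have [xT|Tx] := leqP x T0.
  by apply: leq_trans (leq_addr _ _); rewrite expnSr leq_mul2r leq_exp2r // xT orbT.
rewrite (big_cat_nat (ltnW Tx) xB) /= addnA.
apply: leq_trans (leq_addr _ _).
have : (\sum_(T0 <= k < x) 3 * k.+1 ^ 2 * (k < x) =
        \sum_(T0 <= k < x) 3 * k.+1 ^ 2)%N.
  by apply: eq_big_nat => k /andP[_ ->]; rewrite muln1.
move=> ->; have := ltnW Tx; elim: {Tx xB} x => [|x IH]; first lia.
rewrite leq_eqVlt => /orP[/eqP->|]; first by rewrite big_geq //; lia.
by rewrite ltnS => Tx; rewrite big_nat_recr //=; have := IH Tx; lia.
Qed.

Let level_sum (T0 : nat) (g : nat -> nat) :
  \sum_(n <- S) (\sum_(T0 <= k < B) g k * (k < r n)%N)%N%:R <=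
  \sum_(T0 <= k < B) (g k)%:R * (Bd / k.+1%:R ^+ 3).
Proof.
rewrite -natr_sum exchange_big natr_sum; apply: ler_sum => k _ /=.
rewrite -big_distrr natrM ler_wpM2l //= ler_pdivlMr ?exprn_gt0 ?ltr0n //.
apply: le_trans (level k.+1); rewrite ler_wpM2r ?exprn_ge0 //.
by rewrite size_filter -sum1_count [in leRHS]big_mkcond.
Qed.

(** Small values are bounded through the first moment. Above [T0] the level bound leaves a sum of
    1/(k+1)^2, which telescopes against 1/k - 1/(k+1). *)
Lemma second_moment (T0 : nat) : (0 < T0)%N ->
  \sum_(n <- S) (r n)%:R ^+ 2 <= T0%:R * (\sum_(n <- S) (r n)%:R) + 2 * Bd / T0%:R.
Proof.
move=> T0_gt0; have Bd_ge0 : 0 <= Bd by apply: le_trans (level 0); rewrite mulr_ge0.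
apply: (@le_trans _ _ (\sum_(n <- S) (T0 * r n + \sum_(T0 <= k < B) 2 * k.+1 * (k < r n))%N%:R)).
  rewrite big_seq [leRHS]big_seq; apply: ler_sum => n nS.
  by rewrite -natrX ler_nat square_layers ?r_le.
under eq_bigr do rewrite natrD natrM; rewrite big_split /= -big_distrr lerD2l.
apply: (le_trans (level_sum _ _)).
apply: (@le_trans _ _ (\sum_(T0 <= k < B) 2 * Bd * (k%:R^-1 - k.+1%:R^-1))).
  rewrite big_nat [leRHS]big_nat; apply: ler_sum => k /andP[kT _].
  have k0 : 0 < k%:R :> R by rewrite ltr0n (leq_trans T0_gt0).
  have -> : (2 * k.+1)%:R * (Bd / k.+1%:R ^+ 3) = 2 * Bd * (k.+1%:R ^- 2).
    by rewrite natrM; field; rewrite gt_eqF // ltr0n.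
  rewrite ler_wpM2l ?mulr_ge0 // -natr1.
  have -> : k%:R^-1 - (k%:R + 1)^-1 = (k%:R * (k%:R + 1))^-1 :> R.
    by field; rewrite !gt_eqF // addr_gt0.
  by rewrite lef_pV2 ?posrE ?mulr_gt0 ?exprn_gt0 ?addr_gt0 //; nra.
rewrite -big_distrr /= ler_wpM2l ?mulr_ge0 //.
have [TB|BT] := leqP T0 B; last by rewrite big_geq ?invr_ge0 // ltnW.
rewrite (eq_bigr (fun k => - k.+1%:R^-1 - - k%:R^-1)); last by move=> k _; ring.
rewrite (telescope_sumr (fun k => - k%:R^-1) TB).
by have : 0 <= B%:R^-1 :> R by []; lra.
Qed.

(** Now the sum above [T0] is harmonic, so the largest value [B] enters only through the logarithm
    of its ratio to [T0]. *)
Lemma third_moment (T0 : nat) : (0 < T0)%N ->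
  \sum_(n <- S) (r n)%:R ^+ 3 <=
  T0%:R ^+ 2 * (\sum_(n <- S) (r n)%:R) + 3 * Bd * ln (maxn T0 B)%:R - 3 * Bd * ln T0%:R.
Proof.
move=> T0_gt0; have Bd_ge0 : 0 <= Bd by apply: le_trans (level 0); rewrite mulr_ge0.
apply: (@le_trans _ _ (\sum_(n <- S) (T0 ^ 2 * r n + \sum_(T0 <= k < B) 3 * k.+1 ^ 2 * (k < r n))%N%:R)).
  rewrite big_seq [leRHS]big_seq; apply: ler_sum => n nS.
  by rewrite -natrX ler_nat cube_layers ?r_le.
under eq_bigr do rewrite natrD natrM natrX.
rewrite big_split /= -big_distrr -addrA lerD2l.
apply: (le_trans (level_sum _ _)).
apply: (@le_trans _ _ (\sum_(T0 <= k < B) 3 * Bd * (ln k.+1%:R - ln k%:R))).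
  rewrite big_nat [leRHS]big_nat; apply: ler_sum => k /andP[kT _].
  have k0 : 0 < k%:R :> R by rewrite ltr0n (leq_trans T0_gt0).
  have k1 : 0 < k.+1%:R :> R by rewrite ltr0n.
  have -> : (3 * k.+1 ^ 2)%:R * (Bd / k.+1%:R ^+ 3) = 3 * Bd * (k.+1%:R^-1).
    by rewrite natrM natrX; field; rewrite gt_eqF // ltr0n.
  rewrite ler_wpM2l ?mulr_ge0 //.
  have := @le_ln1Dx R (- k.+1%:R^-1).
  have -> : 1 - k.+1%:R^-1 = k%:R / k.+1%:R :> R.
    by rewrite -natr1; field; rewrite gt_eqF // natr1.
  rewrite ltrN2 invf_lt1 // ltr1n ltnS lt0n -lt0n (leq_trans T0_gt0 kT).
  by move=> /(_ isT); rewrite ln_div ?posrE //; move: (ln k%:R) (ln k.+1%:R) (k.+1%:R^-1) => u v z; lra.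
rewrite -big_distrr /= -mulrBr ler_wpM2l ?mulr_ge0 //.
have [TB|BT] := leqP T0 B; last by rewrite big_geq ?(ltnW BT) // subrr.
by rewrite (telescope_sumr (fun k => ln k%:R) TB).
Qed.

End Moments.

Definition level_const (K c : nat) : nat := (64 * c + 4 * K * (1024 + 4 * c))%N.

Definition energy_const (R : realType) (K c : nat) : R :=
  1 + 4 * (level_const K c)%:R.

Definition cube_energy_const (R : realType) (K c : nat) : R :=
  2 + 3 * (level_const K c)%:R * (4 * c%:R + 4).

(** As in [energy], the sum over [T] supplies one factor: this is the sum of the cubes of
    [reps f]. *)
Definition cube_energy (T : finType) (V : eqType) (f : T -> V) : nat :=
  (\sum_t reps f (f t) ^ 2)%N.

Lemma sum_reps_pow (R : realType) (T : finType) (V : eqType) (f : T -> V) (k : nat) :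
  \sum_(n <- image_seq f) (reps f n)%:R ^+ k.+1 = (\sum_t reps f (f t) ^ k)%N%:R :> R.
Proof.
rewrite natr_sum.
rewrite (sum_reps (fun v => (reps f v ^ k)%N%:R) (undup_uniq (codom f))); last first.
  by move=> t; rewrite mem_undup codom_f.
by apply: eq_bigr => v _; rewrite natrX exprS.
Qed.

Lemma leq_card_energy (T : finType) (V : eqType) (f : T -> V) : (#|T| <= energy f)%N.
Proof.
rewrite -sum1_card; apply: leq_sum => t _; apply/card_gt0P.
by exists t; rewrite inE.
Qed.

(** * Second and third moments of one convolution *)

Section Convolution.
Variables (R : realType) (V : zmodType) (U : finType) (P : U -> V) (K c : nat).
Hypothesis st : few_incidences P K.
Hypothesis U_gt1 : (1 < #|U|)%N.
Variables (T : finType) (f : T -> V).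
Hypothesis U_le_T : (#|U| <= #|T|)%N.
Hypothesis conv_le : forall n, (#|U| * reps (add_point P f) n <= c * #|T|)%N.

Let g := add_point P f.
Let N : R := #|U|%:R.
Let W : R := #|T|%:R.
Let L : R := (level_const K c)%:R.
Variable E : R.
Hypothesis fE : (energy f)%:R <= E.

Let N_gt1 : 1 < N. Proof. by rewrite ltr1n. Qed.
Let W_gt0 : 0 < W. Proof. by rewrite ltr0n (leq_trans _ U_le_T) // ltnW. Qed.
Let N_le_E : N <= E.
Proof.
by apply: le_trans fE; rewrite ler_nat (leq_trans U_le_T) ?leq_card_energy.
Qed.

Let level (tau : nat) :
  (size [seq n <- image_seq g | (tau <= reps g n)%N])%:R * tau%:R ^+ 3 <= L * W * E.
Proof.
set Q := [seq n <- _ | _].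
have [->|[n0 n0Q]] : Q = [::] \/ exists n, n \in Q.
  by case: (Q) => [|n s]; [left|right; exists n; rewrite mem_head].
  rewrite mul0r mulr_ge0 ?mulr_ge0 ?(ltW W_gt0) //.
  by apply: le_trans N_le_E; rewrite ler0n.
have tauU : (#|U| * tau <= c * #|T|)%N.
  apply: leq_trans (conv_le n0); rewrite leq_mul2l; apply/orP; right.
  by move: n0Q; rewrite mem_filter => /andP[].
have Qrich n : n \in Q -> (tau <= reps (add_point P f) n)%N.
  by rewrite mem_filter => /andP[].
have : (size Q * tau ^ 3 <= level_const K c * (#|T| * energy f))%N.
  rewrite mulnA; apply: (level_bound R st _ (ltnW U_gt1) Qrich tauU).
  exact: filter_uniq (undup_uniq _).
rewrite -(ler_nat R) natrM natrX [leRHS]natrM => /le_trans; apply.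
by rewrite -mulrA ler_wpM2l // natrM ler_wpM2l // ltW.
Qed.

Let Bmax := ((c * #|T|) %/ #|U|)%N.
Let reps_le n : n \in image_seq g -> (reps g n <= Bmax)%N.
Proof. by move=> _; rewrite leq_divRL 1?mulnC ?conv_le // ltnW. Qed.

Let sum_reps1 : \sum_(n <- image_seq g) (reps g n)%:R = N * W.
Proof.
rewrite (eq_bigr (fun n => (reps g n)%:R ^+ 1)) // (sum_reps_pow R g 0) /N /W -natrM; congr _%:R.
by under eq_bigr do rewrite expn0; rewrite sum1_card card_prod mulnC.
Qed.

(** Up to the factor [L], this threshold balances T0 N W against L W E / T0 in [second_moment]. *)
Let y := Num.sqrt (E / N).
Let T0 := Num.trunc y.

Let E_gt0 : 0 < E. Proof. by apply: lt_le_trans N_le_E; apply: lt_trans N_gt1. Qed.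
Let N_gt0 : 0 < N. Proof. by apply: lt_trans N_gt1. Qed.
Let y2 : y ^+ 2 * N = E.
Proof. by rewrite sqr_sqrtr ?divr_ge0 ?(ltW E_gt0) ?(ltW N_gt0) // divfK ?gt_eqF. Qed.
Let y_ge1 : 1 <= y.
Proof. by rewrite -(sqrtr1 R) ler_wsqrtr // ler_pdivlMr // mul1r. Qed.
Let T0_gt0 : (0 < T0)%N. Proof. by rewrite truncn_gt0. Qed.
Let T0_le : T0%:R <= y. Proof. by rewrite truncn_le (le_trans ler01). Qed.
Let T0_ge : y <= 2 * T0%:R.
Proof.
have := truncnS_gt y; rewrite -/T0 -natr1.
have : 1 <= T0%:R :> R by rewrite ler1n.
lra.
Qed.

Lemma energy_conv_bound :
  (energy g)%:R ^+ 2 <= energy_const R K c ^+ 2 * N * W ^+ 2 * E.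
Proof.
rewrite /energy_const -/L.
have := second_moment reps_le level T0_gt0.
rewrite (sum_reps_pow _ g 1) sum_reps1.
under eq_bigr do rewrite expn1.
rewrite -/(energy g) => H.
have L_ge0 : 0 <= L by [].
have e1 : (energy g)%:R <= (1 + 4 * L) * (y * N * W).
  apply: (le_trans H).
  have h1 : T0%:R * (N * W) <= y * N * W.
    by rewrite mulrA; rewrite ler_pM2r // ler_pM2r.
  have T00 : 0 < T0%:R :> R by rewrite ltr0n.
  have h2 : 2 * (L * W * E) / T0%:R <= 4 * L * (y * N * W).
    rewrite ler_pdivrMr // -y2.
    have -> : 2 * (L * W * (y ^+ 2 * N)) = 2 * L * (y * N * W) * y by ring.
    have -> : 4 * L * (y * N * W) * T0%:R = 2 * L * (y * N * W) * (2 * T0%:R) by ring.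
    rewrite ler_wpM2l // !mulr_ge0 // ltW //.
    by apply: lt_le_trans y_ge1.
  lra.
have -> : (1 + 4 * L) ^+ 2 * N * W ^+ 2 * E = ((1 + 4 * L) * (y * N * W)) ^+ 2.
  by rewrite -y2; ring.
by rewrite ler_sqr ?nnegrE // (le_trans _ e1).
Qed.

(** The hypothesis gives W <= y N^2, so the maximal value is at most c W/N <= c y N and its ratio to
    [T0] is O(c N). The logarithm is thus that of [N] and not of [W]. As [E] is only an upper bound
    for the energy, it may be enlarged to meet the hypothesis. *)
Lemma cube_energy_conv_bound : W ^+ 2 <= E * N ^+ 3 ->
  (cube_energy g)%:R <= cube_energy_const R K c * W * E * ln N.
Proof.
rewrite /cube_energy_const -/L => WE.
have := third_moment reps_le level T0_gt0.
rewrite (sum_reps_pow _ g 2) sum_reps1 -/(cube_energy g) => H.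
have y_gt0 : 0 < y by apply: lt_le_trans y_ge1.
have yW : W <= y * N ^+ 2.
  rewrite -ler_sqr ?nnegrE ?(ltW W_gt0) ?mulr_ge0 ?exprn_ge0 ?(ltW y_gt0) ?(ltW N_gt0) //.
  by apply: (le_trans WE); rewrite -y2 le_eqVlt; apply/orP; left; apply/eqP; ring.
have T00 : 0 < T0%:R :> R by rewrite ltr0n.
have BE : Bmax%:R * N <= c%:R * W.
  by rewrite -!natrM ler_nat leq_trunc_div.
(* This lets [ln N] absorb the terms without a logarithm. *)
have ln2 : 1 / 2 <= ln N.
  have h : 1 / 2 <= ln 2 :> R.
    have := @le_ln1Dx R (- (1 / 2)).
    have -> : 1 - 1 / 2 = 2^-1 :> R by lra.
    by rewrite lnV ?posrE // => /(_ _); lra.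
  by apply: (le_trans h); rewrite ler_ln ?posrE // ler_nat.
have c0 : 0 <= c%:R :> R by [].
have maxB : (maxn T0 Bmax)%:R <= (2 * c.+1%:R * N) * T0%:R.
  have [BT|TB] := leqP Bmax T0.
    rewrite ler_peMl ?ler0n // -natr1.
    have : 1 <= N := ltW N_gt1.
    by nra.
  rewrite -(ler_pM2r N_gt0); apply: (le_trans BE).
  apply: (@le_trans _ _ (c%:R * (y * N ^+ 2))); first by rewrite ler_wpM2l.
  have -> : 2 * c.+1%:R * N * T0%:R * N = c.+1%:R * (2 * T0%:R * N ^+ 2) by ring.
  apply: ler_pM => //; first by rewrite mulr_ge0 ?exprn_ge0 ?(ltW y_gt0) ?(ltW N_gt0).
    by rewrite ler_nat.
  by rewrite ler_wpM2r // exprn_ge0 // ltW.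
have lnmax : ln (maxn T0 Bmax)%:R - ln T0%:R <= (4 * c%:R + 4) * ln N.
  have m0 : 0 < (maxn T0 Bmax)%:R :> R by rewrite ltr0n leq_max T0_gt0.
  have d0 : 0 < 2 * c.+1%:R :> R by rewrite mulr_gt0 // ltr0n.
  have : ln (maxn T0 Bmax)%:R <= ln (2 * c.+1%:R * N * T0%:R).
    by rewrite ler_ln ?posrE ?mulr_gt0.
  rewrite !lnM ?posrE ?mulr_gt0 //.
  have h : ln (2 * c.+1%:R) <= 2 * c.+1%:R - 1 :> R.
    rewrite [in leLHS](_ : 2 * c.+1%:R = 1 + (2 * c.+1%:R - 1)); last by ring.
    by apply: le_ln1Dx; lra.
  move: h; rewrite lnM ?posrE ?ltr0n // -natr1.
  nra.
apply: (le_trans H).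
have h1 : T0%:R ^+ 2 * (N * W) <= W * E.
  rewrite -y2 mulrA [leRHS]mulrC ler_pM2r // ler_pM2r //.
  by rewrite ler_sqr ?nnegrE // ltW.
have WE0 : 0 <= W * E by rewrite mulr_ge0 ?(ltW W_gt0) ?(ltW E_gt0).
have h2 : W * E <= 2 * (W * E) * ln N by nra.
have h3 : 3 * (L * W * E) * (ln (maxn T0 Bmax)%:R - ln T0%:R) <=
    3 * (L * W * E) * ((4 * c%:R + 4) * ln N).
  rewrite ler_wpM2l // mulr_ge0 // -mulrA mulr_ge0 //.
lra.
Qed.
End Convolution.

(** * Energy of a difference set *)

Lemma cauchy_schwarz_sum (R : realFieldType) (X : Type) (s : seq X) (a b : X -> R) :
  (\sum_(x <- s) a x * b x) ^+ 2 <=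
  (\sum_(x <- s) a x ^+ 2) * (\sum_(x <- s) b x ^+ 2).
Proof.
elim: s => [|x s IH]; first by rewrite !big_nil expr2 !mul0r.
rewrite !big_cons.
have A0 : 0 <= \sum_(x <- s) a x ^+ 2 by apply: sumr_ge0 => *; exact: sqr_ge0.
have B0 : 0 <= \sum_(x <- s) b x ^+ 2 by apply: sumr_ge0 => *; exact: sqr_ge0.
move: IH A0 B0; move: (\sum_(_ <- _) _) => C; move: (\sum_(_ <- _) _) => A.
move: (\sum_(_ <- _) _) => B; move: (a x) (b x) => p q IH A0 B0.
suff : 2 * (p * q) * C <= p ^+ 2 * B + A * q ^+ 2 by lra.
have [pq0|/ltW pq0] := leP (2 * (p * q) * C) 0.
  by apply: (le_trans pq0); rewrite addr_ge0 // mulr_ge0 ?sqr_ge0.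
suff : (2 * (p * q) * C) ^+ 2 <= (p ^+ 2 * B + A * q ^+ 2) ^+ 2.
  rewrite ler_sqr ?nnegrE //.
  by apply: addr_ge0; apply: mulr_ge0 => //; exact: sqr_ge0.
have : (2 * (p * q) * C) ^+ 2 <= 4 * ((p * q) ^+ 2 * (A * B)).
  have -> : (2 * (p * q) * C) ^+ 2 = 4 * ((p * q) ^+ 2 * C ^+ 2) by ring.
  by rewrite ler_wpM2l // ler_wpM2l // sqr_ge0.
have := sqr_ge0 (p ^+ 2 * B - A * q ^+ 2).
lra.
Qed.

Lemma sqr_sum_le (R : realFieldType) (T : finType) (a : T -> R) :
  (\sum_t a t) ^+ 2 <= #|T|%:R * \sum_t a t ^+ 2.
Proof.
have := cauchy_schwarz_sum (index_enum T) (fun=> 1) a.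
under eq_bigr do rewrite mul1r.
move=> /le_trans; apply; apply: ler_wpM2r.
  by apply: sumr_ge0 => *; exact: sqr_ge0.
by under eq_bigr do rewrite expr1n; rewrite sumr_const.
Qed.

Lemma ler_sum_supp (R : numDomainType) (X : eqType) (s1 s2 : seq X) (H : X -> R) :
  uniq s1 -> uniq s2 -> (forall x, 0 <= H x) ->
  (forall x, x \notin s2 -> H x = 0) ->
  \sum_(x <- s1) H x <= \sum_(x <- s2) H x.
Proof.
move=> u1 u2 H0 Hs2.
rewrite (bigID (mem s2)) /= [X in _ + X]big1 ?addr0; last by move=> x /Hs2.
rewrite [leRHS](bigID (mem s1)) /= -big_filter -[X in _ <= X + _]big_filter.
have -> : \sum_(x <- [seq x <- s1 | x \in s2]) H x =
          \sum_(x <- [seq x <- s2 | x \in s1]) H x.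
  apply: perm_big; apply: uniq_perm; rewrite ?filter_uniq // => x.
  by rewrite !mem_filter andbC.
by rewrite lerDl sumr_ge0.
Qed.

Lemma reps_indicator (R : pzSemiRingType) (T : finType) (V : eqType) (f : T -> V) (v : V) :
  (reps f v)%:R = \sum_t (f t == v)%:R :> R.
Proof.
rewrite /reps -sum1_card natr_sum big_mkcond /=.
by apply: eq_bigr => t _; rewrite inE; case: eqP.
Qed.

Lemma energy_indicator (R : pzSemiRingType) (T : finType) (V : eqType) (f : T -> V) :
  (energy f)%:R = \sum_t \sum_t' (f t' == f t)%:R :> R.
Proof.
by rewrite natr_sum; apply: eq_bigr => t _; exact: reps_indicator.
Qed.

Lemma sum_pair (R : nmodType) (T T' : finType) (G : T * T' -> R) :
  \sum_x G x = \sum_t \sum_t' G (t, t').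
Proof. by rewrite pair_bigA; apply: eq_bigr => -[]. Qed.

Lemma subr_eq_swap (V : zmodType) (a b c d : V) :
  (a - b == c - d) = (a - c == b - d).
Proof.
rewrite -subr_eq0 -[RHS]subr_eq0; congr (_ == 0).
by rewrite !opprB !addrA (addrAC (a - b)) (addrAC a (- b)) (addrAC (a - c)).
Qed.

Section DifferenceEnergy.
Variables (R : realType) (V : zmodType) (T : finType) (phi : T -> V).

Definition difference (st : T * T) : V := phi st.1 - phi st.2.

Let f (z : V) : R := (reps difference z)%:R.
Let Z := image_seq difference.
Let E : R := (energy difference)%:R.
Let F : R := (cube_energy difference)%:R.
Let n : R := #|T|%:R.

Let Z_uniq : uniq Z. Proof. exact: undup_uniq. Qed.
Let diff_in_Z s t : phi s - phi t \in Z.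
Proof. by rewrite mem_undup; apply/codomP; exists (s, t). Qed.
Let f_ge0 z : 0 <= f z. Proof. by []. Qed.
Let f_out z : z \notin Z -> f z = 0.
Proof. by rewrite mem_image_seq lt0n negbK /f => /eqP ->. Qed.

Let fE z : f z = \sum_s \sum_t (phi s - phi t == z)%:R.
Proof.
rewrite /f /reps -sum1_card natr_sum big_mkcond /=.
rewrite (pair_bigA _ (fun s t => (phi s - phi t == z)%:R)) /=.
by apply: eq_bigr => st _; rewrite inE; case: eqP.
Qed.

Let f_opp z : f (- z) = f z.
Proof.
rewrite !fE exchange_big; apply: eq_bigr => s _; apply: eq_bigr => t _.
by rewrite -eqr_oppLR opprB.
Qed.

Let sumZ (G : V -> R) : \sum_s \sum_t G (phi s - phi t) = \sum_(z <- Z) f z * G z.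
Proof.
rewrite (pair_bigA _ (fun s t => G (phi s - phi t))) /=.
apply: (@sum_reps R _ _ difference Z G Z_uniq) => -[s t]; exact: diff_in_Z.
Qed.

Let E_sumZ : E = \sum_(z <- Z) f z ^+ 2.
Proof. exact/esym/(sum_reps_pow R difference 1). Qed.

Let F_sumZ : F = \sum_(z <- Z) f z ^+ 3.
Proof. by rewrite (sum_reps_pow R difference 2). Qed.

Let energy6 : R := \sum_(u <- Z) \sum_(v <- Z) f u * f v * f (u + v).

(** * Triangles weighted by truncated difference counts *)

Section Truncated.
Variable D : R.
(** The upper bound for triangles needs a bounded weight. Cutting at [D] costs at most F/D of the
    mass [E], because f^2 <= f^3 / D where f > D. *)
Let g z : R := if f z <= D then f z else 0.
Let g_ge0 z : 0 <= g z. Proof. by rewrite /g; case: ifP. Qed.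
Let g_le_f z : g z <= f z. Proof. by rewrite /g; case: ifP. Qed.
Let g_le_D z : 0 <= D -> g z <= D. Proof. by rewrite /g; case: ifP. Qed.
Let g_opp z : g (- z) = g z. Proof. by rewrite /g f_opp. Qed.

Lemma truncated_mass : 0 < D -> E - F / D <= \sum_s \sum_t g (phi s - phi t).
Proof.
move=> D0; rewrite sumZ E_sumZ F_sumZ mulr_suml -sumrB.
apply: ler_sum => z _; rewrite /g; case: (leP (f z) D) => [_|Df].
  by rewrite -expr2 gerBl divr_ge0 ?exprn_ge0 // ltW.
rewrite mulr0 subr_le0 ler_pdivlMr // [leRHS]exprSr ler_wpM2l ?sqr_ge0 //.
exact: ltW.
Qed.

Let T3 := \sum_a \sum_b \sum_c g (phi a - phi b) * g (phi b - phi c) * f (phi a - phi c).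
Let k a z : R := \sum_t (phi a - phi t == z)%:R.

Let sum_k a (G : V -> R) : \sum_(z <- Z) k a z * G z = \sum_t G (phi a - phi t).
Proof.
under eq_bigr do rewrite /k mulr_suml.
rewrite exchange_big; apply: eq_bigr => t _ /=.
rewrite (bigD1_seq (phi a - phi t)) //= eqxx mul1r big1 ?addr0 // => z.
by rewrite eq_sym => /negbTE ->; rewrite mul0r.
Qed.

(** phi s - phi t = phi a - phi c means phi a - phi s = phi c - phi t. So the third edge weight is a
    Gram matrix, which makes [T3] a sum of squares. *)
Let f_k a c : f (phi a - phi c) = \sum_(z <- Z) k a z * k c z.
Proof.
rewrite sum_k fE; apply: eq_bigr => s _; apply: eq_bigr => t _.
rewrite -subr_eq0 -[in RHS]subr_eq0; congr (_ == 0)%:R.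
by rewrite !opprB !addrA (addrAC (phi s)) (addrAC (phi c)) (addrC (phi s)).
Qed.

Let T3_squares : T3 =
  \sum_(z <- Z) \sum_b (\sum_a g (phi a - phi b) * k a z) ^+ 2.
Proof.
rewrite /T3 exchange_big [RHS]exchange_big; apply: eq_bigr => b _ /=.
under [RHS]eq_bigr do rewrite expr2 big_distrlr.
rewrite [RHS]exchange_big; apply: eq_bigr => a _ /=.
rewrite [RHS]exchange_big; apply: eq_bigr => c _ /=.
rewrite f_k mulr_sumr; apply: eq_bigr => z _.
by rewrite -(opprB (phi c)) g_opp; ring.
Qed.

(** Cauchy-Schwarz over [b], over [z] and over [a]. They are linked by the fact that the sum of
    [Y z * f z] dominates the sum of [G a ^+ 2], because g <= f. *)
Lemma triangle_lower_bound :
  (\sum_s \sum_t g (phi s - phi t)) ^+ 4 <= E * n ^+ 3 * T3.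
Proof.
pose Y z := \sum_b \sum_a g (phi a - phi b) * k a z.
pose G a := \sum_b g (phi a - phi b).
have Y_le : \sum_(z <- Z) Y z ^+ 2 <= n * T3.
  rewrite T3_squares mulr_sumr; apply: ler_sum => z _; exact: sqr_sum_le.
have YG z : Y z = \sum_a G a * k a z.
  rewrite /Y exchange_big; apply: eq_bigr => a _; by rewrite mulr_suml.
have Yf : \sum_(z <- Z) Y z * f z = \sum_a G a * \sum_t f (phi a - phi t).
  under eq_bigr do rewrite YG mulr_suml.
  rewrite exchange_big; apply: eq_bigr => a _ /=.
  rewrite -sum_k mulr_sumr; apply: eq_bigr => z _; by rewrite mulrA.
have G_ge0 a : 0 <= G a by apply: sumr_ge0.
have GG : \sum_a G a ^+ 2 <= \sum_(z <- Z) Y z * f z.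
  rewrite Yf; apply: ler_sum => a _; rewrite expr2 ler_wpM2l //.
  by apply: ler_sum => t _.
have CS := cauchy_schwarz_sum Z Y f; rewrite -E_sumZ in CS.
have G2 : 0 <= \sum_a G a ^+ 2 by apply: sumr_ge0 => a _; exact: sqr_ge0.
have h1 : (\sum_a G a) ^+ 2 <= n * \sum_(z <- Z) Y z * f z.
  by apply: (le_trans (sqr_sum_le G)); rewrite ler_wpM2l.
have n0 : 0 <= n by [].
have E0 : 0 <= E by [].
have -> : \sum_s \sum_t g (phi s - phi t) = \sum_a G a by [].
have -> : (\sum_a G a) ^+ 4 = ((\sum_a G a) ^+ 2) ^+ 2 by rewrite -exprM.
have h2 : ((\sum_a G a) ^+ 2) ^+ 2 <= (n * \sum_(z <- Z) Y z * f z) ^+ 2.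
  by rewrite ler_sqr ?nnegrE ?sqr_ge0 // (le_trans (sqr_ge0 _) h1).
apply: (le_trans h2); rewrite exprMn.
have h3 := ler_wpM2l (sqr_ge0 n) CS.
apply: (le_trans h3).
have h4 := ler_wpM2l (mulr_ge0 (sqr_ge0 n) E0) Y_le.
lra.
Qed.

Let lam (abc : T * T * T) : V * V :=
  (phi abc.1.1 - phi abc.1.2, phi abc.1.2 - phi abc.2).

(** Two triples have the same image when phi a' - phi a, phi b' - phi b and phi c' - phi c agree;
    given b and b', the other two coordinates allow f(phi b' - phi b)^2 choices. *)
Let energy_lam : (energy lam)%:R = F.
Proof.
rewrite energy_indicator !sum_pair /F /cube_energy natr_sum sum_pair.
rewrite exchange_big; apply: eq_bigr => b _ /=.
transitivity (\sum_a \sum_c \sum_b' \sum_a' \sum_c'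
    ((phi a' - phi a == phi b' - phi b)%:R *
     (phi c' - phi c == phi b' - phi b)%:R : R)).
  apply: eq_bigr => a _; apply: eq_bigr => c _.
  rewrite !sum_pair exchange_big; apply: eq_bigr => b' _.
  apply: eq_bigr => a' _; apply: eq_bigr => c' _.
  rewrite /lam /= xpair_eqE -natrM mulnb [X in X && _]subr_eq_swap.
  by rewrite [X in _ && X]subr_eq_swap [X in _ && X]eq_sym.
under [LHS]eq_bigr do rewrite exchange_big /=.
rewrite exchange_big; apply: eq_bigr => b' _ /=.
have fb : (reps difference (difference (b, b')))%:R = f (phi b' - phi b).
  by rewrite -f_opp opprB.
rewrite natrX expr2 fb fE [X in _ = X * X]exchange_big mulr_suml /=.
apply: eq_bigr => a _; rewrite exchange_big mulr_suml; apply: eq_bigr => a' _ /=.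
rewrite mulr_sumr; apply: eq_bigr => c _ /=.
by rewrite mulr_sumr.
Qed.

(** The summand of [T3] depends only on [lam abc], because phi a - phi c is the sum of its two
    components. Cauchy-Schwarz over the values of [lam] produces [energy_lam] as one factor. *)
Lemma triangle_upper_bound : 0 <= D ->
  T3 ^+ 2 <= F * (D ^+ 2 * \sum_(u <- Z) \sum_(v <- Z) g u * g v * f (u + v) ^+ 2).
Proof.
move=> D0.
pose q (uv : V * V) := g uv.1 * g uv.2 * f (uv.1 + uv.2).
have T3q : T3 = \sum_abc q (lam abc).
  rewrite -(pair_bigA _ (fun ab c => q (lam (ab, c)))) /=.
  rewrite -(pair_bigA _ (fun a b => \sum_c q (lam (a, b, c)))) /=.
  apply: eq_bigr => a _; apply: eq_bigr => b _; apply: eq_bigr => c _.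
  by rewrite /q /= addrA subrK.
rewrite T3q (sum_reps q (undup_uniq (codom lam))); last first.
  by move=> t; rewrite mem_undup codom_f.
apply: (le_trans (cauchy_schwarz_sum _ _ _)).
rewrite (sum_reps_pow R lam 1); under [X in X%:R * _]eq_bigr do rewrite expn1.
rewrite -/(energy lam) energy_lam ler_wpM2l //.
pose ZZ := [seq (u, v) | u <- Z, v <- Z].
apply: (@le_trans _ _ (\sum_(uv <- ZZ) q uv ^+ 2)).
  apply: ler_sum_supp; rewrite ?undup_uniq ?allpairs_uniq //.
  - by move=> [u v] [u' v'] _ _.
  - by move=> uv; exact: sqr_ge0.
  move=> [u v] uv; suff : (f u == 0) || (f v == 0).
    rewrite /q /= => uv0; have : (g u == 0) || (g v == 0).
      by rewrite /g; case: ifP; case: ifP; move: uv0; rewrite ?eqxx ?orbT.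
    by move=> /orP[]/eqP ->; rewrite ?mul0r ?mulr0 ?mul0r expr0n.
  apply/negPn; rewrite negb_or; apply: contra uv => /andP[u0 v0].
  apply/allpairsP; exists (u, v); split=> //=.
    by apply: contraNT u0 => /f_out/eqP.
  by apply: contraNT v0 => /f_out/eqP.
rewrite /ZZ big_allpairs_dep /= mulr_sumr; apply: ler_sum => u _.
rewrite mulr_sumr; apply: ler_sum => v _; rewrite /q /= !exprMn mulrA.
rewrite ler_wpM2r ?sqr_ge0 //.
have -> : D ^+ 2 * (g u * g v) = (D * g u) * (D * g v) by ring.
by apply: ler_pM; rewrite ?sqr_ge0 // expr2 ler_wpM2r // g_le_D.
Qed.

(** f(w)^2 <= D2 f(w) + f(w)^3 / D2. The first part gives [energy6]; in the second, f(u) f(v) is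
    split into squares, after which the sum over the other variable is a translate of the sum of
    f^3. *)
Lemma weighted_triples_bound (D2 : R) : 0 < D2 ->
  \sum_(u <- Z) \sum_(v <- Z) g u * g v * f (u + v) ^+ 2 <=
  D2 * energy6 + E * F / D2.
Proof.
move=> D20.
have shift (H : V -> R) u : (forall w, 0 <= H w) -> (forall w, w \notin Z -> H w = 0) ->
    \sum_(v <- Z) H (u + v) <= \sum_(w <- Z) H w.
  move=> H0 HZ; rewrite -(big_map (fun v => u + v) xpredT H).
  by apply: ler_sum_supp => //; rewrite map_inj_uniq //; exact: addrI.
pose tl w := f w ^+ 3 / D2.
have tl_ge0 w : 0 <= tl w by rewrite divr_ge0 ?exprn_ge0 // ltW.
have tl_out w : w \notin Z -> tl w = 0.
  by move=> /f_out; rewrite /tl => ->; rewrite expr0n mul0r.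
have tl_sum : \sum_(w <- Z) tl w = F / D2 by rewrite -mulr_suml -F_sumZ.
apply: (@le_trans _ _ (\sum_(u <- Z) \sum_(v <- Z)
    (D2 * (f u * f v * f (u + v)) + f u ^+ 2 * tl (u + v) / 2 +
     f v ^+ 2 * tl (u + v) / 2))).
  apply: ler_sum => u _; apply: ler_sum => v _.
  have gg : g u * g v <= f u * f v by apply: ler_pM.
  have fuv : f (u + v) ^+ 2 <= D2 * f (u + v) + tl (u + v).
    have [le_D2|/ltW ge_D2] := leP (f (u + v)) D2.
      by rewrite expr2; apply: ler_wpDr => //; rewrite ler_wpM2r.
    apply: ler_wpDl; first by rewrite mulr_ge0 // ltW.
    by rewrite /tl ler_pdivlMr // [leRHS]exprSr ler_wpM2l ?sqr_ge0.
  have am : f u * f v <= f u ^+ 2 / 2 + f v ^+ 2 / 2.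
    by have := sqr_ge0 (f u - f v); lra.
  have gg0 : 0 <= g u * g v by exact: mulr_ge0.
  have h1 := ler_wpM2l gg0 fuv.
  have h2 := ler_wpM2r (mulr_ge0 (ltW D20) (f_ge0 (u + v))) gg.
  have h3 := ler_wpM2r (tl_ge0 (u + v)) (le_trans gg am).
  lra.
have -> : D2 * energy6 + E * F / D2 = D2 * energy6 + E * (F / D2) / 2 + E * (F / D2) / 2.
  by field; rewrite gt_eqF.
under eq_bigr do rewrite !big_split /=.
rewrite !big_split /=; apply: lerD; first apply: lerD.
- by rewrite /energy6 mulr_sumr; apply: ler_sum => u _; rewrite mulr_sumr.
- under eq_bigr do rewrite -mulr_suml -mulr_sumr.
  rewrite -mulr_suml ler_pM2r ?invr_gt0 //.
  rewrite E_sumZ mulr_suml -tl_sum; apply: ler_sum => u _.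
  by rewrite ler_wpM2l ?sqr_ge0 // shift.
rewrite exchange_big /=.
under eq_bigr do rewrite -mulr_suml -mulr_sumr.
rewrite -mulr_suml ler_pM2r ?invr_gt0 //.
rewrite E_sumZ mulr_suml -tl_sum; apply: ler_sum => v _.
by rewrite ler_wpM2l ?sqr_ge0 //; under eq_bigr do rewrite addrC; rewrite shift.
Qed.

End Truncated.

Definition triple_sum (abc : T * (T * T)) : V :=
  phi abc.1 + (phi abc.2.1 + phi abc.2.2).

(** A relation u + v = w between three differences becomes an equation between two sums of three
    values of [phi] when all minus signs change sides. *)
Let energy6_triple : energy6 = (energy triple_sum)%:R.
Proof.
transitivity (\sum_s \sum_t \sum_s' \sum_t' f (phi s - phi t + (phi s' - phi t'))).
  rewrite (sumZ (fun u => \sum_s' \sum_t' f (u + (phi s' - phi t')))).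
  apply: eq_bigr => u _.
  rewrite (sumZ (fun v => f (u + v))) mulr_sumr.
  by apply: eq_bigr => v _; rewrite mulrA.
rewrite energy_indicator !sum_pair; apply: eq_bigr => s _; rewrite sum_pair exchange_big.
apply: eq_bigr => s' _ /=.
transitivity (\sum_t \sum_t' \sum_x \sum_y
    ((phi x + (phi t + phi t') == phi s + (phi s' + phi y))%:R : R)).
  apply: eq_bigr => t _; apply: eq_bigr => t' _; rewrite fE.
  apply: eq_bigr => x _; apply: eq_bigr => y _; congr (_ : bool)%:R.
  rewrite -subr_eq0 -[RHS]subr_eq0; congr (_ == 0).
  rewrite !opprD !opprK !addrA (addrAC _ (- phi y) (- phi s)).
  rewrite (addrAC _ (- phi y) (phi t)) (addrAC _ (- phi y) (- phi s')).
  rewrite (addrAC _ (- phi y) (phi t')).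
  rewrite (addrAC _ (- phi s) (phi t)) (addrAC _ (- phi s') (phi t')).
  by rewrite (addrAC _ (- phi s) (phi t')).
under [LHS]eq_bigr => t _ do under eq_bigr => t' _ do rewrite exchange_big /=.
under [LHS]eq_bigr => t _ do rewrite exchange_big /=.
rewrite exchange_big; apply: eq_bigr => y _ /=; rewrite sum_pair.
under [LHS]eq_bigr => t _ do rewrite exchange_big /=.
rewrite exchange_big; apply: eq_bigr => x _ /=; rewrite sum_pair.
by [].
Qed.

Lemma difference_energy_bound :
  E ^+ 15 <= 2 ^+ 22 * n ^+ 12 * F ^+ 7 * (energy triple_sum)%:R.
Proof.
have [T0|T_gt0] := posnP #|T|.
  have -> : E = 0; last by rewrite expr0n /= !mulr_ge0 ?exprn_ge0.
  rewrite /E /energy big1 // => -[s t] _.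
  by have := max_card (pred1 s); rewrite T0 card1.
have E_gt0 : 0 < E.
  rewrite ltr0n; apply: leq_trans (leq_card_energy _).
  by rewrite card_prod muln_gt0 T_gt0.
have F_gt0 : 0 < F.
  rewrite ltr0n /cube_energy; case/card_gt0P: (T_gt0) => s _.
  rewrite (bigD1 (s, s)) //= ltn_addr // expn_gt0 -mem_image_seq.
  by rewrite [_ \in _]diff_in_Z.
have S_gt0 : 0 < (energy triple_sum)%:R :> R.
  rewrite ltr0n; apply: leq_trans (leq_card_energy _).
  by rewrite !card_prod !muln_gt0 T_gt0.
rewrite -energy6_triple; have := S_gt0; rewrite -energy6_triple.
move: energy6 (@weighted_triples_bound) => S wtb S0.
(* Then F/D = E/2, so truncation keeps half of the mass. *)
pose D := 2 * F / E.
have D_gt0 : 0 < D by rewrite divr_gt0 ?mulr_gt0.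
(* This value of [D2] makes the two terms of [weighted_triples_bound] equal. *)
pose y := Num.sqrt (F * E / S).
have y_gt0 : 0 < y by rewrite sqrtr_gt0 divr_gt0 ?mulr_gt0.
have y2 : y ^+ 2 * S = F * E.
  by rewrite sqr_sqrtr ?divfK ?gt_eqF // divr_ge0 ?mulr_ge0 ?ltW.
have [A [T3 [X [hA hT hX hS]]]] : exists A T3 X : R,
    [/\ E - F / D <= A, A ^+ 4 <= E * n ^+ 3 * T3,
        T3 ^+ 2 <= F * (D ^+ 2 * X) & X <= y * S + E * F / y].
  do 3!eexists; split; last exact: (wtb D _ y_gt0).
  - exact: truncated_mass D_gt0.
  - exact: triangle_lower_bound.
  - exact: triangle_upper_bound (ltW D_gt0).
have n_ge0 : 0 <= n by [].
have T3_ge0 : 0 <= T3.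
  have : 0 <= E * n ^+ 3 * T3.
    by apply: le_trans hT; rewrite (_ : 4 = 2 * 2)%N // exprM sqr_ge0.
  by rewrite pmulr_rge0 // mulr_gt0 // exprn_gt0 // ltr0n.
have A_ge : E / 2 <= A.
  have : F / D = E / 2 by rewrite /D; field; rewrite !gt_eqF.
  lra.
have h1 : E ^+ 3 <= 16 * n ^+ 3 * T3.
  rewrite -(ler_pM2l E_gt0).
  have : (E / 2) ^+ 4 <= A ^+ 4 by rewrite lerXn2r ?nnegrE //; lra.
  have -> : (E / 2) ^+ 4 = E * E ^+ 3 / 16 by field.
  lra.
have h2 : E ^+ 6 <= 2 ^+ 8 * n ^+ 6 * T3 ^+ 2.
  have -> : E ^+ 6 = (E ^+ 3) ^+ 2 by rewrite -exprM.
  have -> : 2 ^+ 8 * n ^+ 6 * T3 ^+ 2 = (16 * n ^+ 3 * T3) ^+ 2 by ring.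
  by rewrite lerXn2r ?nnegrE ?exprn_ge0 ?(ltW E_gt0) // !mulr_ge0 ?exprn_ge0.
have h3 : E ^+ 8 <= 2 ^+ 10 * n ^+ 6 * F ^+ 3 * X.
  have -> : 2 ^+ 10 * n ^+ 6 * F ^+ 3 * X =
      E ^+ 2 * (2 ^+ 8 * n ^+ 6 * (F * (D ^+ 2 * X))).
    by rewrite /D; field; rewrite gt_eqF.
  rewrite (exprD E 2 6) ler_wpM2l ?exprn_ge0 ?(ltW E_gt0) //.
  by apply: (le_trans h2); rewrite ler_wpM2l // mulr_ge0 ?exprn_ge0.
have h4 : X <= 2 * y * S.
  apply: (le_trans hS).
  have -> : E * F / y = y * S.
    have -> : E * F = y ^+ 2 * S by rewrite y2 mulrC.
    by field; rewrite gt_eqF.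
  lra.
have c_ge0 : 0 <= 2 ^+ 10 * n ^+ 6 * F ^+ 3.
  by rewrite !mulr_ge0 ?exprn_ge0 // ltW.
have h5 : E ^+ 8 <= 2 ^+ 10 * n ^+ 6 * F ^+ 3 * (2 * y * S).
  by apply: (le_trans h3); rewrite ler_wpM2l.
rewrite -(ler_pM2l E_gt0) -exprS.
have -> : E ^+ 16 = (E ^+ 8) ^+ 2 by rewrite -exprM.
apply: (@le_trans _ _ ((2 ^+ 10 * n ^+ 6 * F ^+ 3 * (2 * y * S)) ^+ 2)).
  by rewrite lerXn2r ?nnegrE ?exprn_ge0 ?(ltW E_gt0) // (le_trans _ h5) ?exprn_ge0 ?(ltW E_gt0).
have -> : (2 ^+ 10 * n ^+ 6 * F ^+ 3 * (2 * y * S)) ^+ 2 =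
    2 ^+ 22 * n ^+ 12 * F ^+ 6 * (y ^+ 2 * S) * S by ring.
by rewrite y2 le_eqVlt; apply/orP; left; apply/eqP; ring.
Qed.

End DifferenceEnergy.

(** * Energies of iterated sums *)

Lemma reps_bij (T T' : finType) (V : eqType) (b : T -> T') (f : T -> V) (f' : T' -> V) :
  bijective b -> (forall t, f' (b t) = f t) -> reps f =1 reps f'.
Proof.
move=> bb ff' v; rewrite /reps -[RHS](on_card_preimset (onW_bij _ bb)).
by apply: eq_card => t; rewrite !inE ff'.
Qed.

Lemma energy_bij (T T' : finType) (V : eqType) (b : T -> T') (f : T -> V) (f' : T' -> V) :
  bijective b -> (forall t, f' (b t) = f t) -> energy f = energy f'.
Proof.
move=> bb ff'; rewrite /energy [RHS](reindex b) /=; last exact: onW_bij.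
by apply: eq_bigr => t _; rewrite ff' (reps_bij bb ff').
Qed.

Lemma cube_energy_bij (T T' : finType) (V : eqType) (b : T -> T') (f : T -> V) (f' : T' -> V) :
  bijective b -> (forall t, f' (b t) = f t) -> cube_energy f = cube_energy f'.
Proof.
move=> bb ff'; rewrite /cube_energy [RHS](reindex b) /=; last exact: onW_bij.
by apply: eq_bigr => t _; rewrite ff' (reps_bij bb ff').
Qed.

(** Exchange t and t': f s - h t = f s' - h t' is the same as f s + h t' = f s' + h t. *)
Lemma energy_sub_add (R : realType) (V : zmodType) (T T' : finType) (f : T -> V) (h : T' -> V) :
  energy (fun x : T * T' => f x.1 - h x.2) = energy (fun x : T * T' => f x.1 + h x.2).
Proof.
apply/eqP; rewrite -(eqr_nat R) !energy_indicator !sum_pair; apply/eqP.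
apply: eq_bigr => s _.
under eq_bigr do rewrite sum_pair; under [RHS]eq_bigr do rewrite sum_pair.
rewrite exchange_big [RHS]exchange_big; apply: eq_bigr => s' _ /=.
rewrite exchange_big; apply: eq_bigr => t _; apply: eq_bigr => t' _ /=.
by rewrite subr_eq addrAC eq_sym subr_eq eq_sym.
Qed.

(** The constant of [energy_words4] times 56^28, the price for replacing (ln N)^28 by N^(1/2). Being
    at least 1, it bounds its own 59th root. *)
Definition energy4_const (R : realType) (K c : nat) : R :=
  2 ^+ 88 * energy_const R K c ^+ 34 * cube_energy_const R K c ^+ 28 *
  c%:R ^+ 14 * 56 ^+ 28.

(** The summand [energy_const R K c ^+ 2] makes the second factor stable under [energy_words_step],
    whatever the number of steps. *)
Definition final_const (R : realType) (K c : nat) : R :=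
  cube_energy_const R K c * (energy4_const R K c + energy_const R K c ^+ 2).

Lemma energy_const_ge1 (R : realType) (K c : nat) : 1 <= energy_const R K c.
Proof. by rewrite lerDl mulr_ge0. Qed.

Lemma cube_energy_const_ge1 (R : realType) (K c : nat) : 1 <= cube_energy_const R K c.
Proof.
rewrite /cube_energy_const -[X in X + _]/(1 + 1) -addrA lerDl.
by rewrite addr_ge0 // !mulr_ge0 // addr_ge0 ?mulr_ge0.
Qed.

Lemma energy4_const_ge1 (R : realType) (K c : nat) : (0 < c)%N ->
  1 <= energy4_const R K c.
Proof.
move=> c_gt0; have c_ge1 : 1 <= c%:R :> R by rewrite ler1n.
by rewrite /energy4_const !mulr_ege1 ?exprn_ege1 ?energy_const_ge1
  ?cube_energy_const_ge1 ?ler1n.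
Qed.

Lemma final_const_gt0 (R : realType) (K c : nat) : (0 < c)%N ->
  0 < final_const R K c.
Proof.
move=> c_gt0; rewrite mulr_gt0 //.
  exact: lt_le_trans (cube_energy_const_ge1 _ _ _).
by rewrite ltr_wpDr ?sqr_ge0 // (lt_le_trans _ (energy4_const_ge1 R K c_gt0)).
Qed.

Section Words.
Variables (R : realType) (V : zmodType) (U : finType) (P : U -> V) (K c : nat).

(** Nested pairs rather than functions on ['I_s]: one more summand is then a convolution with [P] up
    to a swap of coordinates. *)
Fixpoint words (s : nat) : finType :=
  if s is s'.+1 then (U * words s')%type : finType else unit.

Fixpoint word_sum (s : nat) : words s -> V :=
  match s with
  | 0 => fun=> 0
  | s'.+1 => fun x => P x.1 + word_sum x.2
  end.

Lemma card_words s : #|words s| = (#|U| ^ s)%N.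
Proof. by elim: s => [|s IH]; rewrite ?card_unit // card_prod IH expnS. Qed.

Let E s : R := (energy (@word_sum s))%:R.
Let N : R := #|U|%:R.

Hypothesis st : few_incidences P K.
Hypothesis U_gt1 : (1 < #|U|)%N.
Hypothesis c_gt0 : (0 < c)%N.
Hypothesis pair_le : forall v, (reps (fun ab : U * U => (P ab.1 + P ab.2)%R) v <= c)%N.

Lemma reps_prod_le (T T' : finType) (f : T * T' -> V) (m : nat) (v : V) :
  (forall t', reps (fun t => f (t, t')) v <= m)%N -> (reps f v <= m * #|T'|)%N.
Proof.
move=> fm; rewrite -[reps f v]natn reps_indicator sum_pair exchange_big /=.
rewrite mulnC -sum_nat_const; apply: leq_sum => t' _.
by apply: leq_trans (fm t'); rewrite -[leqRHS]natn reps_indicator.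
Qed.

Definition swap_word s (x : words s * U) : words s.+1 := (x.2, x.1).

Lemma swap_word_bij s : bijective (@swap_word s).
Proof. by exists (fun x => (x.2, x.1)) => -[]. Qed.

Lemma swap_wordE s x : word_sum (@swap_word s x) = add_point P (@word_sum s) x.
Proof. by rewrite /= addrC. Qed.

(** Fix all but two of the summands; the sum condition leaves at most [c] choices for these two. *)
Lemma conv_words_le s n : (0 < s)%N ->
  (#|U| * reps (add_point P (@word_sum s)) n <= c * #|words s|)%N.
Proof.
case: s => // s _; rewrite card_words expnS mulnCA leq_mul2l; apply/orP; right.
rewrite (reps_bij (@swap_word_bij _) (@swap_wordE _)) -card_words.
pose b (x : U * U * words s) : words s.+2 := (x.1.1, (x.1.2, x.2)).
have bb : bijective b.
  by exists (fun x => ((x.1, x.2.1), x.2.2)) => [[[? ?] ?]|[? [? ?]]].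
rewrite -(reps_bij bb (f := fun x => P x.1.1 + (P x.1.2 + word_sum x.2))) //.
apply: reps_prod_le => w; apply: leq_trans (pair_le (n - word_sum w)).
rewrite leq_eqVlt; apply/orP; left; apply/eqP; apply: eq_card => -[x y].
by rewrite !inE /= addrA [in RHS]eq_sym subr_eq eq_sym.
Qed.

Let L1 : R := energy_const R K c.
Let L2 : R := cube_energy_const R K c.

Lemma energy_words_step s : (0 < s)%N ->
  E s.+1 ^+ 2 <= L1 ^+ 2 * N ^+ (2 * s).+1 * E s.
Proof.
move=> s_gt0.
rewrite /E -(energy_bij (@swap_word_bij s) (@swap_wordE s)).
have UT : (#|U| <= #|words s|)%N.
  by rewrite card_words -[leqLHS]expn1 leq_pexp2l // ltnW.
have H := energy_conv_bound st U_gt1 UT (fun n => conv_words_le n s_gt0) (lexx (E s)).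
apply: (le_trans H); rewrite /E card_words natrX -/N -/L1.
by rewrite (exprS N) (mulnC 2) (exprM N) !mulrA.
Qed.

Lemma cube_energy_words s (W : R) : (0 < s)%N -> E s <= W -> N ^+ (2 * s) <= W * N ^+ 3 ->
  (cube_energy (@word_sum s.+1))%:R <= L2 * N ^+ s * W * ln N.
Proof.
move=> s_gt0 EW NW; rewrite -(cube_energy_bij (@swap_word_bij s) (@swap_wordE s)).
have UT : (#|U| <= #|words s|)%N.
  by rewrite card_words -[leqLHS]expn1 leq_pexp2l // ltnW.
have H := cube_energy_conv_bound st U_gt1 UT (fun n => conv_words_le n s_gt0) EW.
by move: H; rewrite card_words natrX -/N -exprM mulnC => /(_ NW).
Qed.

Lemma energy_words2 : E 2 <= c%:R * N ^+ 2.
Proof.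
rewrite -natrX -natrM ler_nat -card_words mulnC -sum_nat_const.
apply: leq_sum => x _; apply: leq_trans (pair_le (@word_sum 2 x)).
pose b (x : U * U) : words 2 := (x.1, (x.2, tt)).
have bb : bijective b by exists (fun x => (x.1, x.2.1)) => [[? ?]|[? [? []]]].
rewrite -(reps_bij bb (f := fun ab => P ab.1 + P ab.2)) // => t.
by rewrite /= addr0.
Qed.

Let pair_sum (ab : U * U) : V := P ab.1 + P ab.2.

Lemma energy_difference4 : energy (difference pair_sum) = energy (@word_sum 4).
Proof.
rewrite (energy_sub_add R pair_sum pair_sum).
pose b (x : U * U * (U * U)) : words 4 := (x.1.1, (x.1.2, (x.2.1, (x.2.2, tt)))).
have bb : bijective b.
  exists (fun x => ((x.1, x.2.1), (x.2.2.1, x.2.2.2.1))).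
    by move=> [[? ?] [? ?]].
  by move=> [? [? [? [? []]]]].
by apply: (energy_bij bb) => x /=; rewrite /pair_sum addr0 !addrA.
Qed.

Lemma energy_triple6 : energy (triple_sum pair_sum) = energy (@word_sum 6).
Proof.
pose b (x : U * U * (U * U * (U * U))) : words 6 :=
  (x.1.1, (x.1.2, (x.2.1.1, (x.2.1.2, (x.2.2.1, (x.2.2.2, tt)))))).
have bb : bijective b.
  exists (fun x => ((x.1, x.2.1), ((x.2.2.1, x.2.2.2.1),
                    (x.2.2.2.2.1, x.2.2.2.2.2.1)))).
    by move=> [[? ?] [[? ?] [? ?]]].
  by move=> [? [? [? [? [? [? []]]]]]].
by apply: (energy_bij bb) => x /=; rewrite /triple_sum /pair_sum addr0 !addrA.
Qed.

(** P a + P b - P c - P d is the convolution of P a - P c - P d with [P], and the former function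
    has the energy of a threefold sum by [energy_sub_add]. *)
Lemma cube_energy_difference (W : R) : E 3 <= W -> N ^+ 3 <= W ->
  (cube_energy (difference pair_sum))%:R <= L2 * N ^+ 3 * W * ln N.
Proof.
move=> EW NW.
pose f (x : U * (U * U)) := P x.1 - pair_sum x.2.
have Ef : (energy f)%:R <= W.
  apply: le_trans EW; rewrite ler_nat leq_eqVlt; apply/orP; left; apply/eqP.
  rewrite (energy_sub_add R P pair_sum).
  pose b (x : U * (U * U)) : words 3 := (x.1, (x.2.1, (x.2.2, tt))).
  have bb : bijective b.
    by exists (fun x => (x.1, (x.2.1, x.2.2.1))) => [[? [? ?]]|[? [? [? []]]]].
  by apply: (energy_bij bb) => x /=; rewrite /pair_sum addr0.
pose b (x : U * (U * U) * U) : U * U * (U * U) := ((x.1.1, x.2), x.1.2).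
have bb : bijective b.
  by exists (fun x => ((x.1.1, x.2), x.1.2)) => [[[? ?] ?]|[[? ?] ?]].
rewrite -(cube_energy_bij bb (f := add_point P f)); last first.
  by move=> x; rewrite /difference /add_point /f /= addrAC.
have cardT : #|{: U * (U * U)}| = (#|U| ^ 3)%N by rewrite !card_prod !expnS expn0 muln1.
have UT : (#|U| <= #|{: U * (U * U)}|)%N.
  by rewrite cardT -[leqLHS]expn1 leq_pexp2l // ltnW.
have conv n : (#|U| * reps (add_point P f) n <= c * #|{: U * (U * U)}|)%N.
  rewrite cardT expnS mulnCA leq_mul2l; apply/orP; right.
  rewrite (reps_bij bb (f' := difference pair_sum)); last first.
    by move=> x; rewrite /difference /add_point /f /= addrAC.
  rewrite -mulnn -card_prod; apply: reps_prod_le => bc.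
  apply: leq_trans (pair_le (n + pair_sum bc)).
  rewrite leq_eqVlt; apply/orP; left; apply/eqP; apply: eq_card => -[x y].
  by rewrite !inE /difference /= subr_eq.
have H := cube_energy_conv_bound st U_gt1 UT conv Ef.
move: H; rewrite cardT natrX -/N => H; apply: H.
by rewrite -exprM (exprD N 3 3) ler_wpM2r // exprn_ge0.
Qed.

(** The fourth power of [difference_energy_bound], with n = N^2, clears the square roots coming from
    E_3 and from the descent from E_6 to E_4. The powers of N are 96 from n^48, 84 + 98 from F^28
    and 31 from E_6^4, in total 309; one factor E_4 on the right cancels, leaving 59. *)
Lemma energy_words4 :
  E 4 ^+ 59 <= 2 ^+ 88 * L1 ^+ 34 * L2 ^+ 28 * c%:R ^+ 14 * N ^+ 309 * ln N ^+ 28.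
Proof.
have E_gt0 s : 0 < E s.
  rewrite ltr0n; apply: leq_trans (leq_card_energy _).
  by rewrite card_words expn_gt0 ltnW.
have N_ge1 : 1 <= N by rewrite ler1n ltnW.
have N_ge0 : 0 <= N by [].
have L1_ge1 : 1 <= L1 by exact: energy_const_ge1.
have L2_ge0 : 0 <= L2 := le_trans ler01 (cube_energy_const_ge1 _ _ _).
have c_ge1 : 1 <= c%:R :> R by rewrite ler1n.
have l_ge0 : 0 <= ln N by rewrite ln_ge0.
(* The bound for E_3^2 given by one step from E_2 <= c N^2. *)
pose X := L1 ^+ 2 * c%:R * N ^+ 7; pose W := Num.sqrt X.
have X_ge0 : 0 <= X by rewrite !mulr_ge0 ?exprn_ge0 // (le_trans ler01).
have W2 : W ^+ 2 = X by rewrite sqr_sqrtr.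
have E3W : E 3 <= W.
  rewrite -(@ler_pXn2r _ 2) ?nnegrE ?sqrtr_ge0 ?(ltW (E_gt0 _)) // W2.
  apply: (le_trans (@energy_words_step 2 isT)).
  have a0 : 0 <= L1 ^+ 2 * N ^+ 5 by rewrite mulr_ge0 ?sqr_ge0 ?exprn_ge0.
  apply: (le_trans (ler_wpM2l a0 energy_words2)).
  by rewrite /X le_eqVlt; apply/orP; left; apply/eqP; ring.
have N3W : N ^+ 3 <= W.
  rewrite -(@ler_pXn2r _ 2) ?nnegrE ?sqrtr_ge0 ?exprn_ge0 // W2 -exprM.
  apply: (@le_trans _ _ (N ^+ 7)); first by rewrite ler_weXn2l.
  by rewrite ler_peMl ?exprn_ge0 // mulr_ege1 // exprn_ege1.
have F_le := cube_energy_difference E3W N3W.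
have := @difference_energy_bound R V _ pair_sum.
rewrite energy_difference4 energy_triple6 -/(E 4) -/(E 6) card_prod natrM -/N.
move: F_le; set F := (cube_energy _)%:R => F_le D4.
have F_ge0 : 0 <= F by [].
have F28 : F ^+ 28 <= L2 ^+ 28 * N ^+ 84 * X ^+ 14 * ln N ^+ 28.
  have -> : L2 ^+ 28 * N ^+ 84 * X ^+ 14 * ln N ^+ 28 = (L2 * N ^+ 3 * W * ln N) ^+ 28.
    have gen (a b d e : R) : a ^+ 28 * b ^+ 84 * (d ^+ 2) ^+ 14 * e ^+ 28 =
        (a * b ^+ 3 * d * e) ^+ 28 by ring.
    by rewrite -W2 gen.
  by rewrite lerXn2r ?nnegrE // !mulr_ge0 ?exprn_ge0 ?sqrtr_ge0.
have E6_le : E 6 ^+ 4 <= L1 ^+ 6 * N ^+ 31 * E 4.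
  have h5 : E 6 ^+ 2 <= L1 ^+ 2 * N ^+ 11 * E 5 := @energy_words_step 5 isT.
  have h4 : E 5 ^+ 2 <= L1 ^+ 2 * N ^+ 9 * E 4 := @energy_words_step 4 isT.
  have e4 : E 6 ^+ 4 <= (L1 ^+ 2 * N ^+ 11 * E 5) ^+ 2.
    by rewrite (exprM _ 2 2) lerXn2r ?nnegrE ?(le_trans _ h5) ?exprn_ge0 ?(ltW (E_gt0 _)).
  apply: (le_trans e4).
  have gen1 (a b d : R) : (a ^+ 2 * b ^+ 11 * d) ^+ 2 = a ^+ 4 * b ^+ 22 * d ^+ 2.
    by ring.
  have gen2 (a b d : R) :
      a ^+ 4 * b ^+ 22 * (a ^+ 2 * b ^+ 9 * d) = a ^+ 6 * b ^+ 31 * d by ring.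
  rewrite gen1 -gen2 ler_wpM2l // mulr_ge0 ?exprn_ge0 //.
  exact: le_trans ler01 L1_ge1.
have E60 : E 4 ^+ 60 <= (2 ^+ 22 * (N * N) ^+ 12) ^+ 4 * F ^+ 28 * E 6 ^+ 4.
  have -> : (2 ^+ 22 * (N * N) ^+ 12) ^+ 4 * F ^+ 28 * E 6 ^+ 4 =
      (2 ^+ 22 * (N * N) ^+ 12 * F ^+ 7 * E 6) ^+ 4.
    have gen (a b d : R) : a ^+ 4 * b ^+ 28 * d ^+ 4 = (a * b ^+ 7 * d) ^+ 4 by ring.
    exact: gen.
  rewrite (exprM _ 15 4) lerXn2r ?nnegrE ?(le_trans _ D4) ?exprn_ge0 ?(ltW (E_gt0 _)) //.
rewrite -(ler_pM2r (E_gt0 4)) -exprSr.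
apply: (le_trans E60).
have FE := ler_pM (exprn_ge0 28 F_ge0) (exprn_ge0 4 (ltW (E_gt0 6))) F28 E6_le.
rewrite -[leLHS]mulrA.
have a0 : 0 <= (2 ^+ 22 * (N * N) ^+ 12) ^+ 4 :> R.
  by rewrite exprn_ge0 // mulr_ge0 ?exprn_ge0 // mulr_ge0.
apply: (le_trans (ler_wpM2l a0 FE)).
rewrite /X le_eqVlt; apply/orP; left; apply/eqP.
have gen (a b d e g h u : R) :
    (u ^+ 22 * (d * d) ^+ 12) ^+ 4 *
    (b ^+ 28 * d ^+ 84 * (a ^+ 2 * h * d ^+ 7) ^+ 14 * e ^+ 28 *
     (a ^+ 6 * d ^+ 31 * g)) =
    u ^+ 88 * a ^+ 34 * b ^+ 28 * h ^+ 14 * d ^+ 309 * e ^+ 28 * g by ring.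
exact: gen.
Qed.

(** * Real exponents and induction on the number of summands *)

Let K4 : R := energy4_const R K c.
Let Kf : R := K4 + L1 ^+ 2.

Let N_ge1 : 1 <= N. Proof. by rewrite ler1n ltnW. Qed.
Let N_gt0 : 0 < N. Proof. exact: lt_le_trans N_ge1. Qed.
Let L1_ge1 : 1 <= L1. Proof. exact: energy_const_ge1. Qed.
Let L2_ge1 : 1 <= L2. Proof. exact: cube_energy_const_ge1. Qed.
Let K4_ge1 : 1 <= K4. Proof. exact: energy4_const_ge1. Qed.

Let powR_natD (m : nat) (r : R) : N `^ (m%:R + r) = N ^+ m * N `^ r.
Proof.
by rewrite powRD ?powR_mulrn ?(ltW N_gt0) // (gt_eqF N_gt0) implybT.
Qed.

(** 56 is twice 28, so the 28th power of the logarithm costs exactly N^(1/2). *)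
Lemma ln_le_powR : ln N <= 56 * N `^ (56^-1).
Proof.
have h : ln (N `^ (56^-1)) <= N `^ (56^-1).
  have := @le_ln1Dx R (N `^ (56^-1) - 1); rewrite [1 + _]addrC subrK => h.
  apply: le_trans (h _) _; last by rewrite gerBl.
  by rewrite ltrBrDr addNr powR_gt0.
have -> : ln N = 56 * ln (N `^ (56^-1)).
  by rewrite ln_powR mulrA divff ?mul1r // pnatr_eq0.
by rewrite ler_wpM2l.
Qed.

Section Exponent.
Variable theta : R.
Hypothesis theta_ge0 : 0 <= theta.
Hypothesis theta_ge : 29 <= 118 * theta.

Lemma energy_words4_powR : E 4 <= K4 * N `^ (5 + theta).
Proof.
have K4_ge0 : 0 <= K4 := le_trans ler01 K4_ge1.
have rhs_ge0 := mulr_ge0 K4_ge0 (powR_ge0 N (5 + theta)).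
rewrite -(@ler_pXn2r _ 59) ?nnegrE //.
apply: (le_trans energy_words4).
have ln28 : ln N ^+ 28 <= 56 ^+ 28 * N `^ (2^-1).
  have -> : N `^ (2^-1) = (N `^ (56^-1)) ^+ 28.
    rewrite -powR_mulrn ?powR_ge0 // -powRrM; congr (_ `^ _).
    by field.
  rewrite -exprMn lerXn2r ?nnegrE ?ln_ge0 ?mulr_ge0 ?powR_ge0 //.
  exact: ln_le_powR.
pose B := 2 ^+ 88 * L1 ^+ 34 * L2 ^+ 28 * c%:R ^+ 14.
have B_ge0 : 0 <= B.
  have L1_ge0 := le_trans ler01 L1_ge1; have L2_ge0 := le_trans ler01 L2_ge1.
  by rewrite /B; do ![exact: exprn_ge0 | apply: mulr_ge0].
apply: (@le_trans _ _ (B * N ^+ 309 * (56 ^+ 28 * N `^ (2^-1)))).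
  by rewrite ler_wpM2l // mulr_ge0 ?exprn_ge0 ?(ltW N_gt0).
have -> : B * N ^+ 309 * (56 ^+ 28 * N `^ (2^-1)) = K4 * (N ^+ 309 * N `^ (2^-1)).
  rewrite /K4 /energy4_const -/L1 -/L2 -/B; move: (56 ^+ 28) => u; move: (N ^+ 309) => v; ring.
rewrite exprMn -powR_natD -[(N `^ _) ^+ _]powR_mulrn ?powR_ge0 // -powRrM.
apply: ler_pM; rewrite ?powR_ge0 //; first exact: ler_eXnr.
(* This is [theta_ge]: 59 theta >= 14.5. *)
have h : 309%:R + 2^-1 <= (5 + theta) * 59%:R :> R by have := theta_ge; lra.
exact: ler_powR h.
Qed.

(** The solution of 2 e(s+1) = 2s + 1 + e(s), the recursion of [energy_words_step], with e(4) = 5 +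
    theta. *)
Definition energy_exponent (s : nat) : R :=
  2 * s%:R - 3 + theta * 2 `^ (4 - s%:R).

Lemma energy_words_powR s : (4 <= s)%N -> E s <= Kf * N `^ energy_exponent s.
Proof.
have L1_ge0 := le_trans ler01 L1_ge1; have K4_ge0 := le_trans ler01 K4_ge1.
have L12 : 0 <= L1 ^+ 2 by exact: sqr_ge0.
have Kf_ge0 : 0 <= Kf by rewrite addr_ge0.
elim: s => // s IH; rewrite leq_eqVlt => /orP[/eqP <-|s4].
  apply: (le_trans energy_words4_powR).
  have -> : energy_exponent 4 = 5 + theta.
    by rewrite /energy_exponent subrr powRr0; ring.
  by rewrite ler_wpM2r ?powR_ge0 // lerDl.
have {}IH := IH s4; have s_gt0 : (0 < s)%N := leq_trans (isT : (0 < 4)%N) s4.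
have rhs_ge0 := mulr_ge0 Kf_ge0 (powR_ge0 N (energy_exponent s.+1)).
rewrite -(@ler_pXn2r _ 2) ?nnegrE //.
apply: (le_trans (energy_words_step s_gt0)).
apply: (@le_trans _ _ (L1 ^+ 2 * N ^+ (2 * s).+1 * (Kf * N `^ energy_exponent s))).
  by rewrite ler_wpM2l // mulr_ge0 ?exprn_ge0 // ltW.
have -> : L1 ^+ 2 * N ^+ (2 * s).+1 * (Kf * N `^ energy_exponent s) =
    (L1 ^+ 2 * Kf) * (N ^+ (2 * s).+1 * N `^ energy_exponent s) by ring.
rewrite -powR_natD exprMn -[(_ `^ _) ^+ 2]powR_mulrn ?powR_ge0 // -powRrM.
have -> : (2 * s).+1%:R + energy_exponent s = energy_exponent s.+1 * 2%:R.
  have -> : (2 * s).+1%:R = 2 * s%:R + 1 :> R by rewrite -natr1 natrM.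
  rewrite /energy_exponent -[s.+1%:R]natr1.
  have -> : 4 - (s%:R + 1) = 4 - s%:R - 1 :> R by ring.
  rewrite [2 `^ (4 - _ - 1)]powRD ?powRN ?powRr1 //; last by rewrite pnatr_eq0 implybT.
  by field.
by rewrite ler_wpM2r ?powR_ge0 // expr2 ler_wpM2r // lerDr.
Qed.

Lemma cube_energy_words_powR s : (5 <= s)%N ->
  (cube_energy (@word_sum s))%:R <=
  final_const R K c * (N `^ (3 * s%:R - 6 + theta * 2 `^ (5 - s%:R)) * ln N).
Proof.
case: s => // s s4.
have Kf_ge1 : 1 <= Kf by rewrite (le_trans K4_ge1) // lerDl sqr_ge0.
(* This serves the side condition N^(2s) <= W N^3 of [cube_energy_words]; the excess over 2s is the
   nonnegative term with [theta]. *)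
have e_ge : (2 * s)%:R <= energy_exponent s + 3%:R.
  rewrite /energy_exponent natrM.
  have : 0 <= theta * 2 `^ (4 - s%:R) by rewrite mulr_ge0 ?powR_ge0.
  by lra.
have s_gt0 : (0 < s)%N := leq_trans (isT : (0 < 4)%N) s4.
have H := @cube_energy_words s _ s_gt0 (energy_words_powR s4).
apply: (le_trans (H _)).
  rewrite -mulrA -(powR_mulrn 3) ?(ltW N_gt0) // -powRD; last by rewrite (gt_eqF N_gt0) implybT.
  rewrite -(powR_mulrn (2 * s)) ?(ltW N_gt0) //.
  apply: (@le_trans _ _ (N `^ (energy_exponent s + 3%:R))); first exact: ler_powR.
  by rewrite ler_peMl ?powR_ge0.
rewrite le_eqVlt; apply/orP; left; apply/eqP.
have -> : N `^ (3 * s.+1%:R - 6 + theta * 2 `^ (5 - s.+1%:R)) =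
    N ^+ s * N `^ energy_exponent s.
  rewrite -powR_natD; congr (_ `^ _); rewrite /energy_exponent -[s.+1%:R]natr1.
  have -> : 5 - (s%:R + 1) = 4 - s%:R :> R by ring.
  by ring.
by rewrite /final_const -/L1 -/L2 -/K4 -/Kf; ring.
Qed.

End Exponent.
End Words.

(** * The theorem *)

Section GraphOverFset.
Variables (R : realType) (I : set R) (psi : R -> R) (A : {fset R}).
Hypothesis AI : [set` A] `<=` I.

Definition graph_point (a : A) : R * R := (val a, psi (val a)).

(** The curves are translates of the whole graph over [I]. If n - graph_point u lies in [M], then
    the translate by this point passes through [n], and different [u] give different translates. *)
Lemma graph_few_incidences (c : nat) : is_interval I ->
  {within I, continuous psi} -> few_differences I psi c%:R -> (0 < c)%N ->
  few_incidences graph_point (2 ^ 13 * c ^ 4).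
Proof.
move=> itvI ctsI diffI c_gt0 M Q t uM uQ t2.
pose p (j : 'I_(size M)) := tnth (in_tuple M) j.
have p_inj : injective p.
  move=> i j; rewrite /p !(tnth_nth 0) /= => /eqP.
  by rewrite nth_uniq // => /eqP/val_inj.
have := incidence_bound itvI ctsI diffI p_inj uQ c_gt0 t2.
apply: leq_trans; rewrite leq_mul2r; apply/orP; right.
apply: leq_sum => n _.
pose B := [set u | n - graph_point u \in M]%SET.
have -> : (\sum_u ((n - graph_point u)%R \in M) = #|B|)%N.
  by rewrite cardsE_sum; apply: eq_bigr => u _; rewrite inE.
rewrite cardE [leqRHS]cardE -(size_map (fun u => n - graph_point u)) -[leqRHS](size_map p).
apply: uniq_leq_size.
  rewrite map_inj_uniq ?enum_uniq // => u v /addrI/oppr_inj[e _].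
  exact: val_inj.
move=> v /mapP[u]; rewrite mem_enum inE => uM' ->.
have /tnthP[j jE] : n - graph_point u \in in_tuple M by [].
rewrite jE -/(p j); apply: map_f; rewrite mem_enum inE.
have [e1 e2] : n.1 - (p j).1 = val u /\ (p j).2 = n.2 - psi (val u).
  by rewrite /p -jE /=; split=> //; ring.
rewrite /defined_at /height e1 e2 addrC subrK eqxx andbT; apply/asboolP/AI.
exact: valP.
Qed.

Lemma graph_pair_le (c : nat) (v : R * R) : few_sums I psi c%:R ->
  (reps (fun ab : A * A => (graph_point ab.1 + graph_point ab.2)%R) v <= c)%N.
Proof.
move=> sumI; rewrite /reps cardE -(size_map (fun ab : A * A => (val ab.1, val ab.2))).
apply: (card_at_most_size (sumI v.1 v.2)).
  rewrite map_inj_uniq ?enum_uniq // => -[a b] [a' b'] [/val_inj -> /val_inj ->] //.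
move=> x /mapP[[a b]]; rewrite mem_enum inE => /eqP <- -> /=.
by split=> //; apply: AI; exact: valP.
Qed.

Definition tuple_sum (s : nat) (x : {ffun 'I_s -> A}) : R * R :=
  \sum_(i < s) graph_point (x i).

Lemma reps_tuple_sum (s : nat) : reps (@tuple_sum s) =1 reps (word_sum graph_point (s := s)).
Proof.
elim: s => [|s IH] v.
  pose b (x : {ffun 'I_0 -> A}) := tt.
  have bb : bijective b.
    exists (fun=> [ffun i : 'I_0 => match i with Ordinal _ h => False_rect _ (notF h) end]).
      by move=> x; apply/ffunP => -[].
    by case.
  by apply: (reps_bij bb) => x; rewrite /tuple_sum big_ord0.
pose b (x : {ffun 'I_s.+1 -> A}) : A * {ffun 'I_s -> A} :=
  (x ord0, [ffun i => x (lift ord0 i)]).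
have bb : bijective b.
  pose b' (y : A * {ffun 'I_s -> A}) : {ffun 'I_s.+1 -> A} :=
    [ffun i => if unlift ord0 i is Some j then y.2 j else y.1].
  exists b'.
    by move=> x; apply/ffunP => i; rewrite ffunE; case: unliftP => [j|] -> //=;
      rewrite ffunE.
  move=> [a y]; rewrite /b /b' ffunE unlift_none /=; congr (_, _).
  by apply/ffunP => i; rewrite !ffunE liftK.
rewrite (reps_bij bb (f' := fun y => graph_point y.1 + tuple_sum y.2)); last first.
  move=> x; rewrite /tuple_sum big_ord_recl /=; congr (_ + _).
  by apply: eq_bigr => i _; rewrite ffunE.
rewrite -[LHS]natn -[RHS]natn !reps_indicator !sum_pair; apply: eq_bigr => a _.
have step (T : finType) (f : T -> R * R) :
    (\sum_t (graph_point a + f t == v)%:R = reps f (v - graph_point a) :> nat).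
  rewrite -[RHS]natn reps_indicator; apply: eq_bigr => t _.
  by rewrite [in RHS]eq_sym subr_eq eq_sym addrC.
by rewrite (step _ (@tuple_sum s)) (step _ (word_sum graph_point (s := s))) IH.
Qed.

Lemma rep_word_sum (s : nat) (n : R * R) :
  rep psi A s n = reps (word_sum graph_point (s := s)) n.
Proof.
rewrite -reps_tuple_sum /rep /reps cardsE; apply: eq_card => x; rewrite !inE.
have -> : tuple_sum x = (\sum_(i < s) val (x i), \sum_(i < s) psi (val (x i))).
  rewrite /tuple_sum [LHS]surjective_pairing; congr (_, _).
    by rewrite (big_morph fst (id1 := 0) (op1 := +%R)).
  by rewrite (big_morph snd (id1 := 0) (op1 := +%R)).
by case: n => n1 n2; rewrite xpair_eqE.
Qed.

Lemma third_energy_cube (s : nat) :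
  third_energy psi A s = (cube_energy (word_sum graph_point (s := s)))%:R.
Proof.
rewrite /third_energy fsbig_finite /=; last exact: finite_rep_support.
rewrite -(sum_reps_pow R _ 2).
under eq_bigr do rewrite rep_word_sum.
apply: perm_big; apply: uniq_perm; rewrite ?fset_uniq ?undup_uniq // => n.
rewrite in_fset_set ?mem_image_seq; last exact: finite_rep_support.
by apply/idP/idP; rewrite inE /= rep_word_sum.
Qed.

End GraphOverFset.

Lemma card_at_most_trunc (R : realType) (T : choiceType) (S : set T) (C : R) :
  card_at_most S C -> card_at_most S ((Num.trunc C).+1%:R : R).
Proof. by move=> [fS SC]; split=> //; apply: (le_trans SC); apply/ltW/truncnS_gt. Qed.

Theorem theorem9p4 (R : realType) (C : R) (hC : 0 < C) :
  exists K : R, 0 < K /\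
    forall (I : set R) (psi : R -> R) (A : {fset R}) (s : nat),
      is_interval I ->
      {within I, continuous psi} ->
      few_differences I psi C ->
      few_sums I psi C ->
      [set` A] `<=` I ->
      (2 <= #|` A|)%N ->
      (5 <= s)%N ->
      third_energy psi A s <=
        K * (#|` A|%:R `^ (3 * s%:R - 6 +
                           (4^-1 - 7246^-1) * 2 `^ (5 - s%:R))
             * ln #|` A|%:R).
Proof.
pose c := (Num.trunc C).+1.
exists (final_const R (2 ^ 13 * c ^ 4) c); split; first exact: final_const_gt0.
move=> I psi A s itvI ctsI diffI sumI AI A2 s5.
have diffIc : few_differences I psi c%:R.
  by move=> d1 d2 d1_neq0; exact/card_at_most_trunc/diffI.
have sumIc : few_sums I psi c%:R.
  by move=> n1 n2; exact/card_at_most_trunc/sumI.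
have cardA : #|{: A}| = #|` A| by rewrite -cardfE.
rewrite third_energy_cube -cardA.
(* With theta = 1/4 - e the condition 29 <= 118 theta says e <= 1/236. *)
have inv_le : 7246^-1 <= 237^-1 :> R.
  by rewrite lef_pV2 ?posrE ?ltr0n // ler_nat.
move: (7246^-1) inv_le => e inv_le.
apply: cube_energy_words_powR => //.
- exact: (graph_few_incidences AI itvI ctsI diffIc).
- by rewrite cardA.
- by move=> v; exact: (graph_pair_le AI).
- lra.
- lra.
Qed.
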